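(* Consider online learning with noisy side observations, with $N$ arms, $T$ rounds and known noise bound $R\ge 0$, against an adaptive environment. For all $t$, let $\alpha^*_t$ be the effective independence number of the observation graph $G_t$, and let $$Q_t=\sum_{i=1}^N \frac{p_{t,i}}{\sum_{j=1}^N p_{t,j}s_{t,(j,i)}^2+\gamma_t}.$$ Then, setting $$\eta_t=\sqrt{\frac{\log N}{2(1+R+R^2)\left(N+\sum_{s=1}^{t-1}Q_s\right)}}\qquad\text{and}\qquad \gamma_t=R\,\eta_t,$$ the regret of Exp3-WIX is bounded as $$R_T=\widetilde{O}\left((1+R)\sqrt{N+\sum_{t=1}^T\alpha^*_t}\right).$$
   Context: **Problem.** Write $[N]=\{1,\dots,N\}$. In each round $t=1,\dots,T$: - The environment selects a loss function with values $\ell_{t,i}\in[0,1]$, $i\in[N]$, and a weighted directed graph $G_t$ on $[N]$ whose arc $i\to j$ has weight $s_{t,(i,j)}\in[0,1]$, with $s_{t,(i,i)}=1$ for all $i$. - The learner picks a (random) arm $I_t\in[N]$ and suffers loss $\ell_{t,I_t}$. - The learner then observes $G_t$ and, for every $i\in[N]$, the feedback $c_{t,i}=s_{t,(I_t,i)}\ell_{t,i}+(1-s_{t,(I_t,i)})\xi_{t,i}$. Each noise variable $\xi_{t,i}$ is zero-mean, satisfies $|\xi_{t,i}|\le R$ for a known constant $R\ge 0$, and is generated independently of all other noise terms and of the history of the process. Let $\mathcal F_t$ be the sigma-algebra capturing the interaction history up to the end of round $t$. The environment is adaptive (non-oblivious): it may choose $\ell_t$ and $G_t$ in full knowledge of the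 history $\mathcal F_{t-1}$. **Regret.** $R_T=\max_{i\in[N]}\mathbb E\left[\sum_{t=1}^T\ell_{t,I_t}-\sum_{t=1}^T\ell_{t,i}\right]$. **Exp3-WIX.** Set $\widehat L_{0,i}=0$ for all $i$. In round $t$, with learning rate $\eta_t$ and implicit exploration parameter $\gamma_t\ge 0$, let $$p_{t,i}=\frac{\exp(-\eta_t\widehat L_{t-1,i})}{\sum_{j=1}^N\exp(-\eta_t\widehat L_{t-1,j})},$$ draw $I_t$ according to $p_t$, and after observing the feedback and $G_t$ set $$\widehat\ell_{t,i}=\frac{s_{t,(I_t,i)}\,c_{t,i}}{\sum_{j=1}^N p_{t,j}s_{t,(j,i)}^2+\gamma_t},\qquad \widehat L_{t,i}=\widehat L_{t-1,i}+\widehat\ell_{t,i}\qquad(i\in[N]).$$ **Effective independence number.** For a weighted directed graph $G$ on $N$ nodes with weights $s_{i,j}\in[0,1]$ and $\varepsilon\in[0,1]$, let $G(\varepsilon)$ be the unweighted directed graph in which arc $i\to j$ is present if and only if $s_{i,j}\ge\varepsilon$. Let $\alpha(\varepsilon)$ be the independence number of $G(\varepsilon)$, i.e. the size of the largest set of nodes such that no two (distinct) nodes in the set are connected. The effective independence number of $G$ is $\alpha^*=\min_{\varepsilon\in[0,1]}\alpha(\varepsilon)/\varepsilon^2$ (the ratio being $+\infty$ at $\varepsilon=0$). **Notation.** $\widetilde O$ is the usual $O$-notation up to logarithmic factors.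
   Formalization: The soft-O hides a polylog in N, T times sqrt(1+min(N, log(1+1/R))); at R=0 this is an extra factor sqrt(1+N), since there the claim fails for directed graphs (steered tournaments with effective independence number 1). The sum of effective independence numbers is bounded in expectation. *)

(* Defs.v *)
(* MathComp-Analysis; the reals are an arbitrary [R : realType], and the noise
   bound R of the mathematical text is written [b]. *)
From HB Require Import structures.
From mathcomp Require Export all_boot all_order all_algebra.
From mathcomp Require Export all_classical all_reals all_analysis.
Export Order.TTheory GRing.Theory Num.Theory.
Export numFieldNormedType.Exports.

Set Implicit Arguments.
Unset Strict Implicit.
Unset Printing Implicit Defensive.

Global Open Scope classical_set_scope.
Global Open Scope ring_scope.

(* A weighted directed graph on N nodes is its weight function:
   [s i j] is the weight of the arc i -> j. *)
Definition threshold_graph (R : realType) (N : nat) (s : 'I_N -> 'I_N -> R)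
  (eps : R) : rel 'I_N := fun i j => eps <= s i j.

(* Quantifying over ordered pairs forbids arcs in both directions; the loops
   i -> i (present since s i i = 1) are ignored. *)
Definition independent (N : nat) (g : rel 'I_N) (A : {set 'I_N}) : bool :=
  [forall i in A, forall j in A, (i != j) ==> ~~ g i j].

Definition independence_number (N : nat) (g : rel 'I_N) : nat :=
  (\max_(A : {set 'I_N} | independent g A) #|A|)%N.

(* The ratio is +oo at eps = 0, so only 0 < eps <= 1 matters. The infimum is
   attained: eps |-> alpha(eps) takes finitely many values and is constant on
   intervals closed on the right. *)
Definition effective_independence_number (R : realType) (N : nat)
  (s : 'I_N -> 'I_N -> R) : R :=
  inf [set (independence_number (threshold_graph s eps))%:R / eps ^+ 2
        | eps in [set eps : R | 0 < eps <= 1]].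

Definition feedback (R : realType) (N : nat) (s : 'I_N -> 'I_N -> R)
  (l xi : 'I_N -> R) (k i : 'I_N) : R :=
  s k i * l i + (1 - s k i) * xi i.

(* [F t] is the history up to the end of round t. It is only required to be a
   filtration to which the interaction is adapted (it need not be generated by
   it), which also allows an environment that uses private randomness. *)
Record is_filtration d (Omega : measurableType d) (T : nat)
  (F : nat -> set (set Omega)) : Prop := {
  filtration_sigma_algebra :
    forall t, (t <= T)%N -> sigma_algebra [set: Omega] (F t);
  filtration_measurable :
    forall t, (t <= T)%N -> F t `<=` @measurable d Omega;
  filtration_nondecreasing :
    forall t u, (t <= u <= T)%N -> F t `<=` F u
}.

(* Measurability with respect to a sub-sigma-algebra [G]. *)
Definition sub_measurable (R : realType) d (Omega : measurableType d)
  (G : set (set Omega)) (f : Omega -> R) : Prop :=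
  forall B : set R, measurable B -> G (f @^-1` B).

(* The rounds are t = 1, ..., T; the values of the processes at other indices
   are irrelevant. *)
Record noisy_environment (R : realType) d (Omega : measurableType d)
  (P : probability Omega R) (N T : nat) (b : R) (F : nat -> set (set Omega))
  (l : nat -> Omega -> 'I_N -> R) (s : nat -> Omega -> 'I_N -> 'I_N -> R)
  (I : nat -> Omega -> 'I_N) (xi : nat -> Omega -> 'I_N -> R) : Prop := {
  loss_range : forall t w i, (0 < t <= T)%N -> 0 <= l t w i <= 1;
  weight_range : forall t w i j, (0 < t <= T)%N -> 0 <= s t w i j <= 1;
  weight_loop : forall t w i, (0 < t <= T)%N -> s t w i i = 1;
  loss_predictable : forall t i, (0 < t <= T)%N ->
    sub_measurable (F t.-1) (fun w => l t w i);
  weight_predictable : forall t i j, (0 < t <= T)%N ->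
    sub_measurable (F t.-1) (fun w => s t w i j);
  arm_adapted : forall t i, (0 < t <= T)%N -> F t [set w | I t w = i];
  noise_adapted : forall t i, (0 < t <= T)%N ->
    sub_measurable (F t) (fun w => xi t w i);
  noise_bounded : forall t w i, (0 < t <= T)%N -> `|xi t w i| <= b;
  noise_centered : forall t i, (0 < t <= T)%N ->
    'E_P[fun w => xi t w i]%E = 0%E;
  (* The noise of round t is independent of the past and of the draw I_t, and
     its coordinates are mutually independent. As the earlier noise terms are
     F (t-1)-measurable, all noise terms are then mutually independent. *)
  noise_independent : forall t (A : set Omega) (k : 'I_N) (B : 'I_N -> set R),
    (0 < t <= T)%N -> F t.-1 A -> (forall i, measurable (B i)) ->
    P (A `&` [set w | I t w = k] `&` [set w | forall i, B i (xi t w i)]) =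
    (P (A `&` [set w | I t w = k]) *
      \prod_(i < N) P [set w | B i (xi t w i)])%E
}.

(* [Q t w] is the quantity that drives the adaptive learning rate. *)
Record exp3_wix (R : realType) d (Omega : measurableType d)
  (N T : nat) (b : R)
  (l : nat -> Omega -> 'I_N -> R) (s : nat -> Omega -> 'I_N -> 'I_N -> R)
  (I : nat -> Omega -> 'I_N) (xi : nat -> Omega -> 'I_N -> R)
  (eta gamma Q : nat -> Omega -> R)
  (p lhat Lhat : nat -> Omega -> 'I_N -> R) : Prop := {
  wix_rate : forall t w, (0 < t <= T)%N ->
    eta t w = Num.sqrt (ln N%:R /
      (2 * (1 + b + b ^+ 2) * (N%:R + \sum_(1 <= u < t) Q u w)));
  wix_exploration : forall t w, (0 < t <= T)%N -> gamma t w = b * eta t w;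
  wix_Lhat0 : forall w i, Lhat 0%N w i = 0;
  wix_p : forall t w i, (0 < t <= T)%N ->
    p t w i = expR (- eta t w * Lhat t.-1 w i) /
              \sum_(j < N) expR (- eta t w * Lhat t.-1 w j);
  wix_lhat : forall t w i, (0 < t <= T)%N ->
    lhat t w i =
      s t w (I t w) i * feedback (s t w) (l t w) (xi t w) (I t w) i /
      (\sum_(j < N) p t w j * s t w j i ^+ 2 + gamma t w);
  wix_Lhat : forall t w i, (0 < t <= T)%N ->
    Lhat t w i = Lhat t.-1 w i + lhat t w i;
  wix_Q : forall t w, (0 < t <= T)%N ->
    Q t w = \sum_(i < N)
      p t w i / (\sum_(j < N) p t w j * s t w j i ^+ 2 + gamma t w)
}.

(* P (I_t = i | F (t-1)) = p_{t,i}. *)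
Definition drawn_according_to (R : realType) d (Omega : measurableType d)
  (P : probability Omega R) (N T : nat) (F : nat -> set (set Omega))
  (I : nat -> Omega -> 'I_N) (p : nat -> Omega -> 'I_N -> R) : Prop :=
  forall t (A : set Omega) (i : 'I_N), (0 < t <= T)%N -> F t.-1 A ->
    P (A `&` [set w | I t w = i]) = (\int[P]_(w in A) (p t w i)%:E)%E.

Definition regret (R : realType) d (Omega : measurableType d)
  (P : probability Omega R) (N T : nat)
  (l : nat -> Omega -> 'I_N -> R) (I : nat -> Omega -> 'I_N) : \bar R :=
  (\big[maxe/-oo]_(i < N)
     'E_P[fun w => (\sum_(1 <= t < T.+1) l t w (I t w) -
                    \sum_(1 <= t < T.+1) l t w i)%R])%E.

(* The implicit exploration gamma_t = b * eta_t enters the regret through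
   log (1 / gamma_t), hence through log (1 / b). As b -> 0 this is capped at N,
   the trivial bound Q_t <= N; for b = 0, where 1 / b = +oo, only the cap is
   left. Some such dependence is needed: without exploration, directed graphs
   with effective independence number 1 (transitive tournaments, with p_t
   geometric along the order) can have Q_t of order N. *)
Definition log_inv_noise (R : realType) (N : nat) (b : R) : R :=
  if b == 0 then N%:R else Num.min N%:R (ln (1 + b^-1)).

(* What the soft-O hides, with universal [C] and [k]: a polylogarithm of N and
   T, and the logarithmic dependence on 1 / b. *)
Definition log_factor (R : realType) (C : R) (k N T : nat) (b : R) : R :=
  C * ln (2 + N%:R + T%:R) ^+ k * Num.sqrt (1 + log_inv_noise N b).

(* Main.v *)
Require Import Defs.
From mathcomp Require Import measurable_realfun.
From mathcomp Require Import ring lra.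

(* Since gamma_t = b eta_t, the estimates satisfy eta_t lhat_t >= -1, so the
   second-order analysis of exponential weights applies on every path:
   sum_t (<p, lhat> - 2 eta <p, lhat^2>) <= Lhat_T j + log N / eta_T. Taking
   expectations round by round, E <p, lhat> loses at most E (gamma Q) against
   the true loss, E lhat_j <= E l_j, and E <p, lhat^2> <= (1 + b^2) E Q; the
   learning rate then balances both sides at sqrt (log N (N + sum_t Q_t)).

   It remains to see that Q_t <= 2 alpha* log (1 + 1 / gamma_t). Keeping only
   the weights above eps reduces this to sum_i p_i / (P_i + gamma) for an
   unweighted graph with independence number a, P_i being the weight of the
   closed in-neighbourhood of i. A greedy choice of independent vertices shows
   that some vertex has P_i >= W / (2 a), where W is the total weight; deleting
   such vertices one after the other compares the sum with the integral of
   1 / (x / (2 a) + gamma). *)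

Set Implicit Arguments.
Unset Strict Implicit.
Unset Printing Implicit Defensive.

(** * Weighted graphs *)

Section graph.
Context (R : realType) (N : nat).
Implicit Types (g : rel 'I_N) (p : 'I_N -> R) (U : {set 'I_N}).

(** The clause [j == i] closes the neighbourhood whatever loops [g] has; ranging over [U] follows
    the graph as vertices are deleted. *)
Definition inweight g p U i : R := \sum_(j in U | (j == i) || g j i) p j.
Definition outweight g p U i : R := \sum_(j in U | (j == i) || g i j) p j.

Lemma inweight_subset g p (U V : {set 'I_N}) i : (forall i,
    0 <= p i) -> U \subset V ->
  inweight g p U i <= inweight g p V i.
Proof.
move=> p0 /fintype.subsetP UV; rewrite /inweight [leRHS](bigID (mem U)) /=.
rewrite ler_wpDr ?sumr_ge0// le_eqVlt; apply/orP; left; apply/eqP.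
by apply: eq_bigl => j; case: (boolP (j \in U)) => [/UV ->|_];
    rewrite ?andbT ?andbF.
Qed.

(** Double counting: both sides sum [p i * p j] over the arcs and diagonal pairs inside [U], grouped
    by head on the left and by tail on the right. *)
Lemma sum_inweight_outweight g p U :
  \sum_(i in U) p i * inweight g p U i = \sum_(i in U) p i * outweight g p U i.
Proof.
under eq_bigr do rewrite /inweight mulr_sumr.
under [RHS]eq_bigr do rewrite /outweight mulr_sumr.
rewrite (exchange_big_dep (fun i => i \in U)) /=; last by move=> i j _ /andP[].
apply: eq_bigr => j jU; under [RHS]eq_bigr do rewrite mulrC.
rewrite [LHS]big_mkcond [RHS]big_mkcond /=; apply: eq_bigr => i _.
by rewrite jU eq_sym mulrC.
Qed.

(* Some vertex has out-weight at most c, since in- and out-weights have the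
   same average; keep it and delete its neighbourhood. *)
Lemma independent_of_inweight_le g p c U : (forall i, 0 < p i) ->
  (forall i, i \in U -> inweight g p U i <= c) ->
  exists A : {set 'I_N}, [/\ A \subset U, independent g A &
    \sum_(i in U) p i <= 2 * c * #|A|%:R].
Proof.
move=> p0; have pge0 i : 0 <= p i by exact: ltW.
have [n] := ubnP #|U|; elim: n U => // n IH U; rewrite ltnS => Un Uc.
have [->|/finset.set0Pn [i0 i0U]] := eqVneq U finset.set0.
  exists finset.set0; split; rewrite ?finset.sub0set//.
    by apply/forall_inP => i; rewrite inE.
  by rewrite big_set0 cards0 mulr0.
have [i iU ic] : exists2 i, i \in U & outweight g p U i <= c.
  apply: contrapT => /forall2NP H0;
      have H i : i \in U -> ~~ (outweight g p U i <= c).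
    by move=> iU; apply/negP => h; case: (H0 i).
  have : \sum_(i in U) p i * c < \sum_(i in U) p i * outweight g p U i.
    rewrite (bigD1 i0)//= [ltRHS](bigD1 i0)//= ltr_leD//.
      by rewrite ltr_pM2l// ltNge H.
    by apply: ler_sum => i /andP[iU _]; rewrite ler_pM2l// ltW// ltNge H.
  rewrite -sum_inweight_outweight ltNge => /negP; apply.
  by apply: ler_sum => i iU; rewrite ler_pM2l// Uc.
(* Neighbours in both directions go, since independence forbids arcs either way; then [i] can join
   any independent subset of [U']. *)
pose U' := [set j in U | ~~ [|| j == i, g j i | g i j]].
have U'U : U' \subset U by apply/fintype.subsetP => j; rewrite inE => /andP[].
have U'i : i \notin U' by rewrite inE eqxx andbF.
have [||A [AU' Aind Aw]] := IH U'.
- apply: leq_trans Un; apply: proper_card; apply/fintype.properP; split => //.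
  by exists i.
- move=> j /(fintype.subsetP U'U) jU; apply: le_trans (Uc _ jU).
  exact: inweight_subset.
exists (i |: A); split.
- by rewrite finset.subUset finset.sub1set iU (fintype.subset_trans AU').
- apply/forall_inP => j jA; apply/forall_inP => k kA; apply/implyP => jk.
  move: jA kA; rewrite !in_setU1 => /predU1P[ji|jA] /predU1P[ki|kA].
  + by rewrite ji ki eqxx in jk.
  + have := fintype.subsetP AU' _ kA; rewrite inE ji => /andP[_].
    by rewrite !negb_or => /and3P[].
  + have := fintype.subsetP AU' _ jA; rewrite inE ki => /andP[_].
    by rewrite !negb_or => /and3P[].
  + by move/forall_inP: Aind => /(_ _ jA)/forall_inP/(_ _ kA)/implyP; apply.
have iA : i \notin A by apply: contra U'i; apply: (fintype.subsetP AU').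
rewrite cardsU1 iA natrD mulrDr mulr1.
(* Each deleted vertex is counted in the in-weight or the out-weight of [i], so one deletion costs
   at most [2 * c]. *)
have UE : \sum_(j in U) p j <= \sum_(j in U') p j +
    (inweight g p U i + outweight g p U i).
  rewrite (bigID (fun j => ~~ [|| j == i, g j i | g i j])) /= lerD//.
    by rewrite le_eqVlt; apply/orP; left; apply/eqP; apply: eq_bigl => j;
        rewrite inE.
  rewrite /inweight /outweight !big_mkcondr -big_split /=.
  apply: ler_sum => j jU; rewrite negbK.
  by case: (j == i); case: (g j i); case: (g i j);
      rewrite /= ?addr0 ?add0r// lerDl.
have := Uc _ iU; lra.
Qed.

Lemma ln_le_sub1 (x : R) : 0 < x -> ln x <= x - 1.
Proof. by move=> x0; have := @le_ln1Dx R (x - 1);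
    rewrite addrCA subrr addr0 => ->//; lra. Qed.

(** Peel off a vertex of largest in-weight. Its term is at most the growth of the right-hand side
    when its weight is put back, and deleting it can only increase the other terms. *)
Lemma sum_div_inweight_le g p gam U : (forall i, 0 < p i) -> 0 < gam ->
  \sum_(i in U) p i / (inweight g p U i + gam) <=
  2 * (independence_number g)%:R *
   ln (1 + (\sum_(i in U) p i) / (2 * (independence_number g)%:R * gam)).
Proof.
move=> p0 gam0; have pge0 i : 0 <= p i by exact: ltW.
set a := (independence_number g)%:R.
have [n] := ubnP #|U|; elim: n U => // n IH U; rewrite ltnS => Un.
have [->|/finset.set0Pn [i0 i0U]] := eqVneq U finset.set0.
  by rewrite !big_set0 mul0r addr0 ln1 mulr0.
have [i iU imax] := @arg_maxP _ _ _ i0 (fun i => i \in U) (inweight g p U) i0U.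
set W := \sum_(i in U) p i.
have WE : W = p i + \sum_(j in U :\ i) p j by rewrite /W (big_setD1 _ iU).
have W'0 : 0 <= \sum_(j in U :\ i) p j by exact: sumr_ge0.
(* The independent-set lemma, with the maximal in-weight as [c]: that in-weight is at least
   [W / (2 * a)]. *)
have iin : W <= 2 * inweight g p U i * a.
  have [A [_ Aind Aw]] := @independent_of_inweight_le g p (inweight g p U i) U
      p0 imax.
  apply: le_trans Aw _; apply: ler_wpM2l.
    by rewrite mulr_ge0// /inweight sumr_ge0.
  by rewrite ler_nat; exact: (@leq_bigmax_cond {set 'I_N} (fun A =>
      independent g A) (fun A => #|A|)).
have i_ge0 : 0 <= inweight g p U i by rewrite /inweight sumr_ge0.
have a0 : 0 < a.
  rewrite lt0r ler0n andbT; apply/eqP => a0; move: iin; rewrite a0 mulr0 WE.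
  by have := p0 i; lra.
rewrite (big_setD1 _ iU) /=.
have H1 : \sum_(j in U :\ i) p j / (inweight g p U j + gam) <=
    \sum_(j in U :\ i) p j / (inweight g p (U :\ i) j + gam).
  apply: ler_sum => j _; rewrite ler_wpM2l// lef_pV2 ?posrE.
  + by rewrite lerD2r inweight_subset// subD1set.
  + by rewrite ltr_wpDl// /inweight sumr_ge0.
  + by rewrite ltr_wpDl// /inweight sumr_ge0.
have /IH /(le_trans H1) H2 : (#|U :\ i| < n)%N.
  by apply: leq_trans Un; rewrite [leqRHS](cardsD1 i) iU.
rewrite addrC; apply: (le_trans (lerD H2 (lexx _))).
set W' := \sum_(j in U :\ i) p j in WE W'0 *.
set c := 2 * a * gam.
have c0 : 0 < c by rewrite !mulr_gt0.
have pi0 := p0 i.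
have x1 : 0 < 1 + W' / c by rewrite ltr_pwDl// divr_ge0// ltW.
have x2 : 0 < 1 + W / c by rewrite ltr_pwDl// divr_ge0 ?ltW// WE; lra.
(* [ln x <= x - 1] at the ratio of the two arguments bounds the growth of the logarithm below by
   [p i / (W + c)], without integrating. *)
have -> : ln (1 + W / c) = ln (1 + W' / c) - ln ((1 + W' / c) / (1 + W / c)).
  by rewrite ln_div ?posrE//; ring.
have Wc : 0 < W + c by lra.
have := @ln_le_sub1 ((1 + W' / c) / (1 + W / c)) (divr_gt0 x1 x2).
have -> : (1 + W' / c) / (1 + W / c) - 1 = - (p i / (W + c)).
  rewrite WE; field; apply/andP; split; lra.
have : p i / (inweight g p U i + gam) <= 2 * a * (p i / (W + c)).
  rewrite mulrCA ler_wpM2l// -[leRHS]invrK lef_pV2 ?posrE ?invr_gt0 ?divr_gt0//.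
    by rewrite invf_div ler_pdivrMr ?mulr_gt0// /c; lra.
    by lra.
  by rewrite mulr_gt0.
set v := ln _; set u := ln _; set x := p i / (W + c) => hx hv.
have : 0 <= 2 * a * (- x - v).
  rewrite mulr_ge0 ?subr_ge0// mulr_ge0// ltW//.
lra.
Qed.
End graph.

(** * Exponential weights *)

Section hedge.
Context (R : realType).

(** Squaring [1 - x / 2 <= expR (- x / 2)], whose left side is positive, bounds [expR x] by the
    inverse of [(1 - x / 2) ^+ 2]; a polynomial comparison is left. *)
Lemma expR_le_quadratic (x : R) : x <= 1 -> expR x <= 1 + x + 2 * x ^+ 2.
Proof.
move=> x1; have h := expR_ge1Dx (- x / 2); have e0 := expR_gt0 x.
have E : expR x * expR (- x / 2) ^+ 2 = 1.
  rewrite -expRM_natl -expRD -[RHS]expR0; congr expR; lra.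
have h2 : (1 - x / 2) ^+ 2 <= expR (- x / 2) ^+ 2.
  by rewrite ler_pXn2r// ?nnegrE ?expR_ge0//; lra.
have : expR x * (1 - x / 2) ^+ 2 <= 1 by rewrite -[leRHS]E ler_wpM2l// ltW.
(* The difference of the two sides is half of the product shown nonnegative next. *)
have : 1 <= (1 - x / 2) ^+ 2 * (1 + x + 2 * x ^+ 2).
  have : 0 <= x ^+ 2 * ((1 - x) * (5 / 2 - x))
      by rewrite mulr_ge0 ?sqr_ge0// mulr_ge0; lra.
  by nra.
have : 0 < (1 - x / 2) ^+ 2 by rewrite exprn_gt0//; lra.
set q := (1 - x / 2) ^+ 2 => q0 h3 h4.
by rewrite -(ler_pM2r q0); lra.
Qed.

(** Convexity of the exponential between [0] and [c]: the tangent at [a * c] is evaluated at both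
    ends, and the two bounds are averaged with weights [1 - a] and [a]. *)
Lemma expR_scale_le (a c : R) : 0 <= a <= 1 ->
  expR (a * c) <= 1 + a * (expR c - 1).
Proof.
move=> /andP[a0 a1].
have e0 := expR_gt0 (a * c).
have h1 : expR (a * c) * (1 + (1 - a) * c) <= expR c.
  have -> : expR c = expR (a * c) * expR ((1 - a) * c) by rewrite -expRD;
      congr expR; ring.
  by rewrite ler_pM2l// expR_ge1Dx.
have h2 : expR (a * c) * (1 + - (a * c)) <= 1.
  by rewrite -[leRHS](expRxMexpNx_1 (a * c)) ler_pM2l// expR_ge1Dx.
have := ler_wpM2l a0 h1; have : 0 <= 1 - a by lra.
move=> /ler_wpM2l/(_ _ _ h2); lra.
Qed.

(* The potential [sum_i exp (- eta_t * (L_t i - V_t)) <= N] survives a decrease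
   of the learning rate because [x |-> x ^ a] is concave for [a <= 1]. *)
Lemma exponential_weights_bound (N T : nat) (eta : nat -> R)
    (x L p : nat -> 'I_N -> R) (j : 'I_N) :
  (0 < T)%N ->
  (forall t, (0 < t <= T)%N -> 0 < eta t) ->
  (forall t, (0 < t < T)%N -> eta t.+1 <= eta t) ->
  (forall i, L 0%N i = 0) ->
  (forall t i, (0 < t <= T)%N -> L t i = L t.-1 i + x t i) ->
  (forall t i, (0 < t <= T)%N -> p t i = expR (- eta t * L t.-1 i) /
     \sum_(k < N) expR (- eta t * L t.-1 k)) ->
  (forall t i, (0 < t <= T)%N -> - 1 <= eta t * x t i) ->
  \sum_(1 <= t < T.+1) (\sum_(i < N) p t i * x t i -
     2 * eta t * \sum_(i < N) p t i * x t i ^+ 2) <=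
  L T j + ln N%:R / eta T.
Proof.
move=> T0 eta0 etaD L0 LS pE xge.
have N0 : (0 < N)%N by apply: leq_ltn_trans (ltn_ord j).
pose v t := \sum_(i < N) p t i * x t i - 2 * eta t * \sum_(i < N) p t i * x t i
    ^+ 2.
(* The contribution of rounds [1] to [t] to the left-hand side of the goal, used as the shift in the
   potential. *)
pose V t := \sum_(1 <= u < t.+1) v u.
have VS t : V t.+1 = V t + v t.+1 by rewrite /V big_nat_recr.
have step t : (t < T)%N ->
    \sum_(i < N) expR (- eta t.+1 * (L t i - V t)) <= N%:R ->
    \sum_(i < N) expR (- eta t.+1 * (L t.+1 i - V t.+1)) <= N%:R.
  move=> tT; apply: le_trans.
  have tT' : (0 < t.+1 <= T)%N by [].
  set e := eta t.+1; set Z := \sum_(k < N) expR (- e * L t k).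
  have Z0 : 0 < Z.
    rewrite /Z (bigD1 j)//= ltr_wpDr ?expR_gt0//.
    by apply: sumr_ge0 => i _; exact: expR_ge0.
  have p1 : \sum_(i < N) p t.+1 i = 1.
    under eq_bigr do rewrite pE//.
    by rewrite -mulr_suml divff// gt_eqF.
  have -> : \sum_(i < N) expR (- e * (L t i - V t)) = Z * expR (e * V t).
    by rewrite mulr_suml; apply: eq_bigr => i _; rewrite -expRD; congr expR;
        ring.
  have -> : \sum_(i < N) expR (- e * (L t.+1 i - V t.+1)) =
      Z * expR (e * V t) * expR (e * v t.+1) * \sum_(i < N) p t.+1 i * expR (-
          (e * x t.+1 i)).
    rewrite mulr_sumr; apply: eq_bigr => i _.
    rewrite (pE _ _ tT') (LS _ _ tT') /= VS -/e -/Z.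
    have -> : - e * (L t i + x t.+1 i - (V t + v t.+1)) =
       e * V t + e * v t.+1 + (- e * L t i) + (- (e * x t.+1 i)) by ring.
    by rewrite !expRD; field; rewrite gt_eqF.
  rewrite -[leRHS]mulr1 -mulrA; apply: ler_wpM2l.
    by rewrite mulr_ge0 ?expR_ge0// ltW.
  suff h : \sum_(i < N) p t.+1 i * expR (- (e * x t.+1 i)) <= expR (- (e * v
      t.+1)).
    apply: (le_trans (ler_wpM2l (expR_ge0 _) h)).
    by rewrite expRxMexpNx_1.
  apply: le_trans (expR_ge1Dx _).
  (* By the choice of [v], the tangent bound [1 - e * v] is exactly the [p]-average of the quadratic
     bounds on [expR (- (e * x))]. *)
  have -> : 1 + - (e * v t.+1) = \sum_(i < N) p t.+1 i * (1 +
      - (e * x t.+1 i) + 2 * (- (e * x t.+1 i)) ^+ 2).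
    under eq_bigr do rewrite !mulrDr mulr1.
    rewrite !big_split /= p1 /v -addrA; congr (1 + _).
    rewrite -/e mulrBr opprB addrC -mulrN !mulr_sumr -sumrN mulr_sumr
        -!big_split /=.
    by apply: eq_bigr => i _; ring.
  apply: ler_sum => i _; rewrite ler_wpM2l//.
    by rewrite pE// divr_ge0 ?expR_ge0// ltW.
  by apply: expR_le_quadratic; rewrite lerNl xge.
have main t : (t < T)%N -> \sum_(i < N) expR (- eta t.+1 * (L t.+1 i - V t.+1))
    <= N%:R.
  elim: t => [tT|t IH tT]; apply: step => //.
    rewrite (eq_bigr (fun=> 1)).
      by rewrite sumr_const card_ord.
    by move=> i _; rewrite L0 /V big_geq// subrr mulr0 expR0.
  have /IH {}IH : (t < T)%N by exact: ltnW.
  have e1 : 0 < eta t.+1 by apply: eta0; rewrite /= ltnW.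
  have e2 : 0 < eta t.+2 by apply: eta0.
  have e12 : eta t.+2 <= eta t.+1 by apply: etaD.
  (* The change of rate raises every term of the potential to the power [a]; the tangent at 1 bounds
     the new sum by [N + a * (old sum - N)], hence by [N]. *)
  pose a := eta t.+2 / eta t.+1.
  have a01 : 0 <= a <= 1 by rewrite /a ler_pdivrMr// mul1r e12 andbT divr_ge0//
      ltW.
  apply: (@le_trans _ _ (\sum_(i < N) (1 +
      a * (expR (- eta t.+1 * (L t.+1 i - V t.+1)) - 1)))).
    apply: ler_sum => i _.
    apply: le_trans (expR_scale_le _ a01).
    rewrite le_eqVlt; apply/orP; left; apply/eqP; congr expR.
    by rewrite /a; field; rewrite gt_eqF.
  rewrite big_split /= -mulr_sumr sumrB !sumr_const card_ord.
  case/andP: a01 => a0 _.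
  have : a * (\sum_(i < N) expR (- eta t.+1 * (L t.+1 i - V t.+1)) - N%:R) <= 0.
    by rewrite mulr_ge0_le0// subr_le0.
  lra.
case: T T0 main eta0 {etaD LS pE xge step} => // T _ /(_ T (ltnSn T)) main eta0.
have e0 : 0 < eta T.+1 by apply: eta0; rewrite /= leqnn.
have h : expR (- eta T.+1 * (L T.+1 j - V T.+1)) <= N%:R.
  apply: le_trans main; rewrite (bigD1 j)//= lerDl.
  by apply: sumr_ge0 => i _; exact: expR_ge0.
have : - eta T.+1 * (L T.+1 j - V T.+1) <= ln N%:R.
  by rewrite -[leLHS]expRK ler_ln ?posrE ?expR_gt0 ?ltr0n.
rewrite -/(V T.+1) => h'.
rewrite -lerBlDl ler_pdivlMr//; lra.
Qed.

End hedge.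

(** * Observation weights and the learning rate *)

Section observation.
Context (R : realType) (N : nat).
Implicit Types (s : 'I_N -> 'I_N -> R) (p : 'I_N -> R).

Lemma independence_number_ge1 (g : rel 'I_N) : (0 < N)%N ->
  1 <= (independence_number g)%:R :> R.
Proof.
case: N g => // n g _; rewrite ler1n.
have ind : independent g [set ord0]%SET.
  apply/forall_inP => i /finset.set1P ->;
      apply/forall_inP => j /finset.set1P ->.
  by rewrite eqxx.
have := @leq_bigmax_cond {set 'I_n.+1} (fun A => independent g A) (fun A =>
    #|A|) _ ind.
by rewrite cards1.
Qed.

Lemma le_effective_independence_number s (x : R) :
  (forall eps, 0 < eps <= 1 ->
    x * eps ^+ 2 <= (independence_number (threshold_graph s eps))%:R) ->
  x <= effective_independence_number s.
Proof.
move=> h; apply: lb_le_inf.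
  by exists ((independence_number (threshold_graph s 1))%:R / 1 ^+ 2);
      exists 1 => //=; rewrite ltr01 lexx.
move=> _ [eps /= eps01 <-]; have /andP[e0 _] := eps01.
by rewrite ler_pdivlMr ?exprn_gt0// h.
Qed.

(** Threshold graphs have independent singletons, and [eps ^+ 2 <= 1]. It allows bounds that ignore
    the graph to be multiplied by the effective independence number. *)
Lemma effective_independence_number_ge1 s : (0 < N)%N ->
  1 <= effective_independence_number s.
Proof.
move=> N0; apply: le_effective_independence_number => eps /andP[e0 e1].
by rewrite mul1r (le_trans _ (independence_number_ge1 _ N0))// expr_le1// ltW.
Qed.

Definition observation_weight s p i : R := \sum_(j < N) p j * s j i ^+ 2.

(** The value of [Q_t] at fixed weights, probabilities and exploration; this isolates a
    deterministic statement on graphs. *)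
Definition total_inverse_weight s p gam : R :=
  \sum_(i < N) p i / (observation_weight s p i + gam).

Lemma le_observation_weight s p i : (forall i, 0 <= p i) -> s i i = 1 ->
  p i <= observation_weight s p i.
Proof.
move=> p0 sii; rewrite /observation_weight (bigD1 i)//= sii expr1n mulr1 lerDl.
by apply: sumr_ge0 => j _; rewrite mulr_ge0// sqr_ge0.
Qed.

Lemma total_inverse_weight_bounds s p gam : (forall i, 0 < p i) ->
  (forall i, s i i = 1) -> 0 <= gam -> 0 <= total_inverse_weight s p gam <=
      N%:R.
Proof.
move=> p0 sii gam0.
have w i : p i <= observation_weight s p i + gam.
  by rewrite ler_wpDr// le_observation_weight// => j; exact: ltW.
apply/andP; split.
  by apply: sumr_ge0 => i _; rewrite divr_ge0// ?(le_trans _ (w i))// ltW.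
rewrite -[N in leRHS]card_ord -sumr_const; apply: ler_sum => i _.
by rewrite ler_pdivrMr ?mul1r// (lt_le_trans _ (w i)).
Qed.

(** For each threshold, observation weights are at least [eps ^+ 2] times the in-weights of the
    threshold graph, which costs the factor [1 / eps ^+ 2] of the effective independence number. *)
Lemma total_inverse_weight_le_effective s p gam : (0 < N)%N ->
  (forall i, 0 < p i) -> \sum_(i < N) p i = 1 -> 0 < gam ->
  (forall i, s i i = 1) ->
  total_inverse_weight s p gam <=
  2 * effective_independence_number s * ln (1 + gam^-1).
Proof.
move=> N0 p0 p1 gam0 sii; have pge0 i : 0 <= p i by exact: ltW.
have l0 : 0 < ln (1 + gam^-1) by rewrite ln_gt0// ltrDl invr_gt0.
rewrite mulrAC -ler_pdivrMl ?mulr_gt0//.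
apply: le_effective_independence_number => eps /andP[e0 e1].
set g := threshold_graph s eps; set a := (independence_number g)%:R.
have a1 : 1 <= a by exact: independence_number_ge1.
have a0 : 0 < a by exact: lt_le_trans a1.
have eps2 : 0 < eps ^+ 2 by rewrite exprn_gt0.
have eps21 : eps ^+ 2 <= 1 by rewrite expr_le1// ltW.
have in0 i : 0 <= inweight g p [set: 'I_N]%SET i by rewrite /inweight sumr_ge0.
have le_in i : eps ^+ 2 * (inweight g p [set: 'I_N]%SET i +
    gam) <= observation_weight s p i + gam.
  rewrite mulrDr lerD//; last by rewrite ler_piMl// ltW.
  rewrite /inweight /observation_weight mulr_sumr big_mkcond /=;
      apply: ler_sum => j _.
  rewrite finset.in_setT /=; case: ifPn => [/predU1P[->|h]|_].
  - by rewrite sii expr1n mulr1 ler_piMl.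
  - rewrite mulrC ler_wpM2l// ler_pXn2r// nnegrE; first exact: ltW.
    by apply: le_trans h; exact: ltW.
  - by rewrite mulr_ge0// sqr_ge0.
have le1 : total_inverse_weight s p gam * eps ^+ 2 <=
    \sum_(i in [set: 'I_N]%SET) p i / (inweight g p [set: 'I_N]%SET i + gam).
  rewrite [leRHS](eq_bigl xpredT); last by move=> i; rewrite finset.in_setT.
  rewrite /total_inverse_weight mulr_suml; apply: ler_sum => i _.
  have ig : 0 < inweight g p [set: 'I_N]%SET i + gam by rewrite ltr_wpDl.
  have dg := lt_le_trans (mulr_gt0 eps2 ig) (le_in i).
  rewrite -mulrA ler_wpM2l// mulrC ler_pdivrMr// mulrC ler_pdivlMr//.
have := sum_div_inweight_le g [set: 'I_N]%SET p0 gam0.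
have -> : \sum_(i in [set: 'I_N]%SET) p i = 1.
  by rewrite -p1; apply: eq_bigl => i; rewrite finset.in_setT.
move=> /(le_trans le1) le2.
rewrite -mulrA ler_pdivrMl ?mulr_gt0//; apply: (le_trans le2).
(* As [2 * a >= 1], [2 * a * gam] can be replaced by [gam], which frees the logarithm from the
   threshold. *)
rewrite -/a [leRHS]mulrAC ler_wpM2l//; first by rewrite mulr_ge0// ltW.
rewrite ler_ln ?posrE ?ltr_pwDl ?divr_ge0 ?invr_ge0 ?mulr_ge0// ?(ltW gam0)
    ?(ltW a0)//.
rewrite lerD2l mul1r lef_pV2 ?posrE ?mulr_gt0//.
by rewrite ler_peMl ?ltW//; lra.
Qed.

End observation.

(** * Summation of the adaptive learning rate *)

Section tuning.
Context (R : realType).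

(** Since [q t <= a], the partial sums at most double in one step, so consecutive roots satisfy
    [r' <= 2 * r] and [q t = (r' - r) * (r' + r) <= 3 * r * (r' - r)], which telescopes. *)
Lemma sum_div_sqrt_le (a : R) (q : nat -> R) (T : nat) : 0 < a ->
  (forall t, (0 < t <= T)%N -> 0 <= q t <= a) ->
  \sum_(1 <= t < T.+1) q t / Num.sqrt (a + \sum_(1 <= u < t) q u) <=
  3 * Num.sqrt (a + \sum_(1 <= u < T.+1) q u).
Proof.
move=> a0; elim: T => [_|T IH h].
  by rewrite !big_geq// mulr_ge0.
rewrite big_nat_recr//= [in leRHS]big_nat_recr//= addrA.
have q0 : 0 <= \sum_(1 <= u < T.+1) q u.
  by rewrite big_nat sumr_ge0// => i /andP[i0 iT];
      have /andP[] : 0 <= q i <= a by apply: h; rewrite i0 ltnW.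
have /andP[qT0 qTa] := h T.+1 (leqnn _).
have {}/IH IH : forall t, (0 < t <= T)%N -> 0 <= q t <= a.
  by move=> t /andP[t0 tT]; apply: h; rewrite t0 ltnW.
set S := a + _ in IH *; set x := q T.+1 in qT0 qTa *.
have S0 : 0 < S by rewrite /S; lra.
set r := Num.sqrt S in IH *; set r' := Num.sqrt (S + x).
have r0 : 0 < r by rewrite sqrtr_gt0.
have r2 : r ^+ 2 = S by rewrite sqr_sqrtr// ltW.
have r'2 : r' ^+ 2 = S + x by rewrite sqr_sqrtr//; lra.
have r'0 : 0 <= r' by exact: sqrtr_ge0.
apply: (le_trans (lerD IH (lexx _))).
suff : x / r <= 3 * (r' - r) by lra.
rewrite ler_pdivrMr//.
have r'r : r <= r' by rewrite ler_wsqrtr//; lra.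
have : r' <= 2 * r.
  rewrite -(ler_pXn2r (n := 2))// ?nnegrE ?mulr_ge0// ?ltW//.
  by rewrite exprMn r'2 r2 /S; move: qTa; rewrite /S; nra.
have : x = (r' - r) * (r' + r) by rewrite -subr_sqr r'2 r2; ring.
by move=> ->; nra.
Qed.

(** [k * eta t] is [Num.sqrt (k * ln N%:R)] over the root of the partial sum before round [t]. The
    sum contributes 3 times the final root and the term in [eta T] at most once more, whence 4. *)
Lemma adaptive_rate_bound (N T : nat) (k : R) (q eta : nat -> R) :
  (1 < N)%N -> 0 < k -> (0 < T)%N ->
  (forall t, (0 < t <= T)%N -> 0 <= q t <= N%:R) ->
  (forall t, (0 < t <= T)%N ->
    eta t = Num.sqrt (ln N%:R / (k * (N%:R + \sum_(1 <= u < t) q u)))) ->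
  ln N%:R / eta T + k * \sum_(1 <= t < T.+1) eta t * q t <=
  4 * Num.sqrt (k * ln N%:R) * Num.sqrt (N%:R + \sum_(1 <= u < T.+1) q u).
Proof.
move=> N1 k0 T0 h etaE.
have N0 : 0 < N%:R :> R by rewrite ltr0n ltnW.
have l0 : 0 < ln N%:R :> R by rewrite ln_gt0// ltr1n.
pose S t := N%:R + \sum_(1 <= u < t) q u.
have S0 t : (t <= T.+1)%N -> 0 < S t.
  move=> tT; rewrite /S ltr_wpDr// big_nat sumr_ge0// => i /andP[i0 it].
  by have /andP[] : 0 <= q i <= N%:R by apply: h;
      rewrite i0 -ltnS (leq_trans it).
have etaE' t : (0 < t <= T)%N -> k * eta t =
    Num.sqrt (k * ln N%:R) / Num.sqrt (S t).
  move=> tT; rewrite etaE// -/(S t).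
  have St : 0 < S t by apply: S0; case/andP: tT => _ /leqW.
  have -> : ln N%:R / (k * S t) = (k * ln N%:R) / (k ^+ 2 * S t) by field;
      rewrite !gt_eqF.
  rewrite sqrtrM ?mulr_ge0// ?ltW// sqrtrV ?mulr_ge0// ?sqr_ge0// ?ltW//.
  rewrite (sqrtrM _ (sqr_ge0 k)) sqrtr_sqr gtr0_norm//; field.
  by rewrite !gt_eqF// sqrtr_gt0.
have rk : 0 < Num.sqrt (k * ln N%:R) by rewrite sqrtr_gt0 mulr_gt0.
have r2 : k * ln N%:R = Num.sqrt (k * ln N%:R) ^+ 2.
  by rewrite sqr_sqrtr// mulr_ge0 ?ltW.
have -> : k * \sum_(1 <= t < T.+1) eta t * q t =
    Num.sqrt (k * ln N%:R) * \sum_(1 <= t < T.+1) q t / Num.sqrt (S t).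
  rewrite !mulr_sumr !big_nat; apply: eq_bigr => t tT; rewrite mulrA etaE'//.
  by rewrite mulrAC mulrA.
have H1 := ler_wpM2l (ltW rk) (sum_div_sqrt_le N0 h).
have H2 : ln N%:R / eta T <= Num.sqrt (k * ln N%:R) * Num.sqrt (S T.+1).
  have TT : (0 < T <= T)%N by rewrite T0 /=.
  have ST : 0 < Num.sqrt (S T) by rewrite sqrtr_gt0 S0.
  have -> : ln N%:R / eta T = (k * ln N%:R) / (k * eta T).
    by rewrite -mulf_div divff ?mul1r// gt_eqF.
  rewrite etaE'//; set r := Num.sqrt (k * _) in rk r2 *.
  have -> : k * ln N%:R / (r / Num.sqrt (S T)) = r * Num.sqrt (S T).
    by rewrite r2; field; rewrite !gt_eqF.
  apply: ler_wpM2l; first exact: ltW.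
  rewrite ler_wsqrtr// /S big_nat_recr//= addrA lerDl.
  by have /andP[] := h T TT.
rewrite -/(S T.+1) in H1 *.
have := lerD H2 H1; lra.
Qed.

End tuning.

(** * Bounded functions measurable for a sub-sigma-algebra *)

Section bounded_measurable.
Context (R : realType) d (Omega : measurableType d) (G : set (set Omega)).
Hypothesis sigG : sigma_algebra [set: Omega] G.
Implicit Types f g : Omega -> R.

(** Boundedness gives integrability under a probability, and the class is stable under every
    operation of the algorithm, inverses requiring a positive lower bound. *)
Definition bounded_sub_measurable f :=
  sub_measurable G f /\ exists M, forall w, `|f w| <= M.
Local Notation bm := bounded_sub_measurable.

(** As [G] is the sigma-algebra that it generates, the usual closure properties of measurable
    functions apply on [g_sigma_algebraType G]. *)
Lemma sub_measurableE f :
  sub_measurable G f <-> measurable_fun [set: g_sigma_algebraType G] f.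
Proof.
have GE : G = <<s G >> by rewrite sigma_algebra_id.
split => [h _ B mB|h B mB].
  by rewrite setTI; apply: sub_sigma_algebra; apply: h.
by rewrite GE; have := h measurableT B mB; rewrite setTI.
Qed.

Lemma bm_cst c : bm (fun=> c).
Proof.
split; first by apply/sub_measurableE; exact: measurable_cst.
by exists `|c|.
Qed.

Lemma bmD f g : bm f -> bm g -> bm (fun w => f w + g w).
Proof.
move=> [/sub_measurableE mf [M hM]] [/sub_measurableE mg [M' hM']]; split.
  by apply/sub_measurableE; exact: measurable_funD.
by exists (M + M') => w; rewrite (le_trans (ler_normD _ _))// lerD.
Qed.

Lemma bmM f g : bm f -> bm g -> bm (fun w => f w * g w).
Proof.
move=> [/sub_measurableE mf [M hM]] [/sub_measurableE mg [M' hM']]; split.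
  by apply/sub_measurableE; exact: measurable_funM.
by exists (M * M') => w; rewrite normrM ler_pM.
Qed.

Lemma bmN f : bm f -> bm (fun w => - f w).
Proof.
move=> hf; have := bmM (bm_cst (-1)) hf.
by congr (bm _); apply/funext => w; rewrite mulN1r.
Qed.

Lemma bmB f g : bm f -> bm g -> bm (fun w => f w - g w).
Proof. by move=> hf /bmN; exact: bmD. Qed.

Lemma bmX f n : bm f -> bm (fun w => f w ^+ n).
Proof.
move=> hf; elim: n => [|n IH]; first exact: bm_cst.
by have := bmM hf IH; congr (bm _); apply/funext => w; rewrite exprS.
Qed.

Lemma bm_sum I (r : seq I) (Q : pred I) (h : I -> Omega -> R) :
  (forall i, Q i -> bm (h i)) -> bm (fun w => \sum_(i <- r | Q i) h i w).
Proof.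
move=> hh; elim: r => [|i r IH].
  by have := bm_cst 0; congr (bm _); apply/funext => w; rewrite big_nil.
case: (boolP (Q i)) => Qi.
  by have := bmD (hh _ Qi) IH; congr (bm _); apply/funext => w;
      rewrite big_cons Qi.
by move: IH; congr (bm _); apply/funext => w; rewrite big_cons (negbTE Qi).
Qed.

Lemma bm_sum_nat m n (h : nat -> Omega -> R) :
  (forall i, (m <= i < n)%N -> bm (h i)) -> bm (fun w =>
      \sum_(m <= i < n) h i w).
Proof.
move=> hh; have := @bm_sum _ (index_iota m n) (fun i => (m <= i < n)%N) h hh.
by congr (bm _); apply/funext => w; rewrite [RHS]big_nat.
Qed.

Lemma bm_expR f : bm f -> bm (fun w => expR (f w)).
Proof.
move=> [/sub_measurableE mf [M hM]]; split.
  by apply/sub_measurableE; apply: measurableT_comp => //;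
      exact: measurable_expR.
exists (expR M) => w; rewrite ger0_norm ?expR_ge0// ler_expR.
exact: le_trans (ler_norm _) (hM w).
Qed.

Lemma bm_sqrt f : bm f -> bm (fun w => Num.sqrt (f w)).
Proof.
move=> [/sub_measurableE mf [M hM]]; split.
  apply/sub_measurableE; apply: measurableT_comp => //.
  by apply: continuous_measurable_fun; exact: sqrt_continuous.
exists (Num.sqrt M) => w; rewrite ger0_norm ?sqrtr_ge0// ler_wsqrtr//.
exact: le_trans (ler_norm _) (hM w).
Qed.

Lemma bmV f c : 0 < c -> (forall w, c <= f w) -> bm f -> bm (fun w => (f w)^-1).
Proof.
move=> c0 cf [/sub_measurableE mf _];
    have f0 w : 0 < f w by apply: lt_le_trans (cf w).
split; last first.
  exists c^-1 => w; rewrite ger0_norm; first by rewrite lef_pV2 ?posrE.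
  by rewrite invr_ge0 ltW.
apply/sub_measurableE.
rewrite (_ : (fun w => _) = fun w : g_sigma_algebraType G =>
    expR (- ln (f w))); last first.
  by apply/funext => w; rewrite expRN lnK ?posrE.
apply: measurableT_comp => //.
exact: measurable_funN (measurableT_comp (@measurable_ln R) mf).
Qed.

Lemma bm_indic A : G A -> bm \1_A.
Proof.
move=> GA; split; last by exists 1 => w; rewrite indicE; case: (_ \in _);
    rewrite ?normr1 ?normr0.
apply/sub_measurableE; apply: measurable_indic.
by apply: sub_sigma_algebra.
Qed.

End bounded_measurable.

Arguments bm_indic {R d Omega G} sigG {A}.

Lemma bm_sub (R : realType) d (Omega : measurableType d) (G H : set (set
    Omega)) (f : Omega -> R) :
  G `<=` H -> bounded_sub_measurable G f -> bounded_sub_measurable H f.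
Proof. by move=> GH [mf bf]; split=> // B mB; apply: GH; exact: mf. Qed.

(** * Expectations of bounded random variables *)

Section expectation.
Context (R : realType) d (Omega : measurableType d) (P : probability Omega R).
Implicit Types f g : Omega -> R.

Local Notation bm := (bounded_sub_measurable (@measurable d Omega)).
Local Notation E f := (\int[P]_w f w).

Lemma sigma_algebra_measurable : sigma_algebra [set: Omega] (@measurable d
    Omega).
Proof.
split; first exact: measurable0.
  by move=> A mA; rewrite setTD; exact: measurableC.
by move=> A mA; exact: bigcup_measurable.
Qed.
Let sm := sigma_algebra_measurable.

Lemma bm_measurable f : bm f -> measurable_fun [set: Omega] f.
Proof. by move=> [mf _] _ B mB; rewrite setTI; exact: mf. Qed.

Lemma bm_integrable f : bm f -> P.-integrable [set: Omega] (EFin \o f).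
Proof.
move=> bf; apply: measurable_bounded_integrable => //.
- exact: fin_num_fun_lty.
- exact: bm_measurable.
- case: bf => _ [M hM]; exists M; split; first exact: num_real.
  by move=> x Mx w _ /=; apply: le_trans (hM w) (ltW Mx).
Qed.

Lemma expectationEFin f : bm f -> 'E_P[f]%E = (E f)%:E.
Proof.
move=> bf; rewrite unlock /Rintegral fineK//.
exact: integrable_fin_num (bm_integrable bf).
Qed.

Lemma E_ext f g : f =1 g -> E f = E g.
Proof. by move=> /funext ->. Qed.

Lemma ED f g : bm f -> bm g -> E (fun w => f w + g w) = E f + E g.
Proof. by move=> bf bg; rewrite RintegralD//; exact: bm_integrable. Qed.

Lemma EZ c f : bm f -> E (fun w => c * f w) = c * E f.
Proof. by move=> bf; rewrite RintegralZl//; exact: bm_integrable. Qed.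

Lemma EB f g : bm f -> bm g -> E (fun w => f w - g w) = E f - E g.
Proof. by move=> bf bg; rewrite RintegralB//; exact: bm_integrable. Qed.

Lemma E_le f g : bm f -> bm g -> (forall w, f w <= g w) -> E f <= E g.
Proof. by move=> bf bg fg; apply: le_Rintegral => //; exact: bm_integrable. Qed.

Lemma E_cst c : E (fun=> c) = c.
Proof. rewrite Rintegral_cst// -[RHS]mulr1; congr (_ * _);
    transitivity (fine (1%:E : \bar R)) => //; congr fine;
    exact: probability_setT. Qed.

Lemma E_sum I (r : seq I) (Q : pred I) (h : I -> Omega -> R) :
  (forall i, Q i -> bm (h i)) ->
  E (fun w => \sum_(i <- r | Q i) h i w) = \sum_(i <- r | Q i) E (h i).
Proof.
move=> hh; elim: r => [|i r IH].
  rewrite big_nil -[RHS](E_cst 0); apply: E_ext => w; rewrite big_nil//.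
rewrite big_cons -IH; case: ifPn => Qi.
  rewrite -ED; [|exact: hh|exact: (bm_sum sm)].
  by apply: E_ext => w; rewrite big_cons Qi.
by apply: E_ext => w; rewrite big_cons (negbTE Qi).
Qed.

Lemma E_sum_nat m n (h : nat -> Omega -> R) :
  (forall i, (m <= i < n)%N -> bm (h i)) ->
  E (fun w => \sum_(m <= i < n) h i w) = \sum_(m <= i < n) E (h i).
Proof.
move=> hh; have := @E_sum _ (index_iota m n) (fun i => (m <= i < n)%N) h hh.
rewrite -big_nat => <-; apply: E_ext => w; rewrite big_nat//.
Qed.

Lemma E_indic A : measurable A -> E (\1_A : Omega -> R) = fine (P A).
Proof. by move=> mA; rewrite /Rintegral integral_indic// setIT. Qed.

Lemma E_norm_le f c : bm f -> (forall w, `|f w| <= c) -> `|E f| <= c.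
Proof.
move=> bf fc; rewrite ler_norml -[X in X <= _ <= _](E_cst (- c)) -[X in _ <= _
    <= X](E_cst c).
by apply/andP; split; apply: E_le => //; try exact: bm_cst;
  move=> w; have := fc w; rewrite ler_norml => /andP[].
Qed.

(** The sum counts the positive multiples of [e] up to [z], so [z] is rounded down to the grid;
    [z < m.+1%:R * e] ensures that [m] steps are enough. *)
Lemma staircase_approx (e z : R) m : 0 < e -> 0 <= z < m.+1%:R * e ->
  `|z - e * \sum_(k < m) ((k.+1%:R * e <= z)%R)%:R| <= e.
Proof.
move=> e0; elim: m => [|m IH] /andP[z0 zm].
  by rewrite big_ord0 mulr0 subr0 ger0_norm// ltW//; rewrite mul1r in zm.
rewrite big_ord_recr /=; have [h|h] := leP (m.+1%:R * e) z; last first.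
  by rewrite addr0 IH// z0.
rewrite (eq_bigr (fun=> 1)); last first.
  move=> k _; rewrite (le_trans _ h)//; apply: ler_wpM2r; first exact: ltW.
  by rewrite ler_nat ltnS ltnW.
rewrite sumr_const card_ord natr1 ger0_norm; last by rewrite subr_ge0 mulrC.
by move: zm; rewrite -(natr1 m.+1); lra.
Qed.

(* [Z] is approximated uniformly by a combination of indicators of the events
   [a <= Z]. *)
Lemma E_mul_eq0 (Z W : Omega -> R) : bm Z -> bm W ->
  (forall B : set R, measurable B -> E (fun w => \1_(Z @^-1` B) w * W w) = 0) ->
  E (fun w => Z w * W w) = 0.
Proof.
move=> bZ bW h; case: (bZ) => mZ [M hM]; case: (bW) => _ [K hK].
have b1 B : measurable B -> bm (fun w => \1_(Z @^-1` B) w * W w).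
  by move=> mB; apply: (bmM sm) => //; exact: (bm_indic sm (mZ B mB)).
have approx (e : R) : 0 < e -> `|E (fun w => Z w * W w)| <= e * `|K|.
  move=> e0.
  (* Enough steps of height [e] to cover the range of [Z] shifted by the absolute value of [M],
     which makes it nonnegative. *)
  have [m hm] : exists m : nat, 2 * `|M| < m.+1%:R * e.
    exists (Num.truncn (2 * `|M| / e)).
    by rewrite -ltr_pdivrMr//; apply: truncnS_gt.
  pose B k := [set x : R | k.+1%:R * e - `|M| <= x].
  have mB k : measurable (B k) by rewrite /B -set_itvE; exact: measurable_itv.
  pose Z' w := - `|M| + e * \sum_(k < m) \1_(Z @^-1` B k) w.
  have bZ' : bm Z'.
    apply: (bmD sm); first exact: bm_cst.
    apply: (bmM sm); first exact: bm_cst.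
    by apply: (bm_sum sm) => k _; exact: (bm_indic sm (mZ _ (mB k))).
  have EZ' : E (fun w => Z' w * W w) = 0.
    (* The constant part of [Z'] is a multiple of an indicator as well, that of the preimage of
       [setT], so the hypothesis kills every term. *)
    rewrite (_ : (fun w => _) = fun w => - `|M| * (\1_(Z @^-1` setT) w * W w) +
        e * \sum_(k < m) (\1_(Z @^-1` B k) w * W w)).
      have bS : bm (fun w => \sum_(k < m) (\1_(Z @^-1` B k) w * W w)).
        by apply: (bm_sum sm) => k _; exact: b1.
      have bT := b1 _ measurableT.
      rewrite ED; [|exact: (bmM sm (bm_cst sm _) bT)|exact: (bmM sm (bm_cst sm
          _) bS)].
      rewrite !EZ// h// mulr0 add0r E_sum; last by move=> k _; exact: b1.
      by rewrite big1 ?mulr0// => k _; rewrite h.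
    apply/funext => w; rewrite /Z' mulrDl -mulrA mulr_suml.
    by rewrite preimage_setT indicT mul1r.
  rewrite -[X in `|X|]subr0 -EZ' -EB; [|exact: (bmM sm)|exact: (bmM sm)].
  apply: E_norm_le; first by apply: (bmB sm); exact: (bmM sm).
  move=> w; rewrite -mulrBl normrM ler_pM// ?(le_trans (hK w)) ?ler_norm//.
  have -> : Z w - Z' w = (Z w + `|M|) - e * \sum_(k < m) ((k.+1%:R * e <= Z w +
      `|M|)%R)%:R.
    rewrite /Z' opprD opprK addrA; congr (_ - e * _); apply: eq_bigr => k _.
    rewrite indicE; congr (nat_of_bool _)%:R; rewrite -lerBlDr.
    by apply/idP/idP; rewrite inE.
  apply: staircase_approx => //; have := hM w; have := ler_norm M.
  by rewrite ler_norml => h1 /andP[h2 h3]; apply/andP; split; lra.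
apply/eqP; rewrite -normr_le0; apply/ler_addgt0Pr => e e0; rewrite add0r.
have K1 : 0 < `|K| + 1 by rewrite ltr_wpDl.
apply: le_trans (approx (e / (`|K| + 1)) (divr_gt0 e0 K1)) _.
by rewrite mulrAC ler_pdivrMr// ler_wpM2l ?ltW//; lra.
Qed.

End expectation.

(** * The Exp3-WIX process *)

Section process.
Context (R : realType) (N T : nat) (b : R) d (Omega : measurableType d)
  (P : probability Omega R) (F : nat -> set (set Omega))
  (l : nat -> Omega -> 'I_N -> R) (s : nat -> Omega -> 'I_N -> 'I_N -> R)
  (I : nat -> Omega -> 'I_N) (xi : nat -> Omega -> 'I_N -> R)
  (eta gamma Q : nat -> Omega -> R) (p lhat Lhat : nat -> Omega -> 'I_N -> R).
Context (N0 : (0 < N)%N) (b0 : 0 <= b) (filF : is_filtration T F)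
  (env : noisy_environment P T b F l s I xi)
  (wix : exp3_wix T b l s I xi eta gamma Q p lhat Lhat)
  (draw : drawn_according_to P T F I p).

Local Notation bm t := (bounded_sub_measurable (F t)).
Local Notation bmeas := (bounded_sub_measurable (@measurable d Omega)).
Local Notation E f := (\int[P]_w f w).
Local Notation D t i := (fun w => observation_weight (s t w) (p t w) i).
Local Notation W t i := (fun w =>
    (observation_weight (s t w) (p t w) i + gamma t w)^-1).

Let sigF t : (t <= T)%N -> sigma_algebra [set: Omega] (F t).
Proof. exact: filtration_sigma_algebra filF t. Qed.

Let sm := @sigma_algebra_measurable d Omega.

Let predT t : (0 < t <= T)%N -> (t.-1 <= T)%N.
Proof. by case: t => // t /andP[_ /ltnW]. Qed.

Lemma bm_next t (f : Omega -> R) : (0 < t <= T)%N -> bm t.-1 f -> bm t f.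
Proof.
case: t => // t tT; apply: bm_sub; apply: (filtration_nondecreasing filF).
by rewrite /= leqnSn.
Qed.

Lemma bm_meas t (f : Omega -> R) : (t <= T)%N -> bm t f -> bmeas f.
Proof. by move=> tT; apply: bm_sub; exact: (filtration_measurable filF). Qed.

Lemma bm_pred_meas t (f : Omega -> R) : (0 < t <= T)%N -> bm t.-1 f -> bmeas f.
Proof. by move=> /predT; exact: bm_meas. Qed.

Lemma eta_ge0 t w : (0 < t <= T)%N -> 0 <= eta t w.
Proof. by move=> tT; rewrite (wix_rate wix)// sqrtr_ge0. Qed.

Lemma gamma_ge0 t w : (0 < t <= T)%N -> 0 <= gamma t w.
Proof. by move=> tT; rewrite (wix_exploration wix)// mulr_ge0// eta_ge0. Qed.

Lemma sum_expR_gt0 (f : 'I_N -> R) : 0 < \sum_(i < N) expR (f i).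
Proof.
case: N N0 f => // n _ f; rewrite big_ord_recl ltr_wpDr ?expR_gt0//.
by apply: sumr_ge0 => i _; exact: expR_ge0.
Qed.

Lemma p_gt0 t w i : (0 < t <= T)%N -> 0 < p t w i.
Proof. by move=> tT; rewrite (wix_p wix)// divr_gt0 ?expR_gt0 ?sum_expR_gt0.
    Qed.

Lemma p_sum1 t w : (0 < t <= T)%N -> \sum_(i < N) p t w i = 1.
Proof.
move=> tT; under eq_bigr do rewrite (wix_p wix)//.
by rewrite -mulr_suml divff// gt_eqF// sum_expR_gt0.
Qed.

Lemma QE t w : (0 < t <= T)%N -> Q t w =
    total_inverse_weight (s t w) (p t w) (gamma t w).
Proof. by move=> tT; rewrite (wix_Q wix). Qed.

Lemma Q_bounds t w : (0 < t <= T)%N -> 0 <= Q t w <= N%:R.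
Proof.
move=> tT; rewrite QE// total_inverse_weight_bounds// ?gamma_ge0//.
  by move=> i; exact: p_gt0.
by move=> i; rewrite (weight_loop env).
Qed.

Lemma sum_Q_ge0 t w : (t <= T.+1)%N -> 0 <= \sum_(1 <= u < t) Q u w.
Proof.
move=> tT; rewrite big_nat sumr_ge0// => u /andP[u0 ut].
by have /andP[] : 0 <= Q u w <= N%:R by apply: Q_bounds;
    rewrite u0 -ltnS (leq_trans ut).
Qed.

Lemma observation_weight_ge t w i : (0 < t <= T)%N -> p t w i <= D t i w.
Proof.
move=> tT; rewrite le_observation_weight//; last by rewrite (weight_loop env).
by move=> j; rewrite ltW// p_gt0.
Qed.

Lemma weight_gt0 t w i : (0 < t <= T)%N -> 0 < D t i w + gamma t w.
Proof.
move=> tT; rewrite ltr_wpDr ?gamma_ge0// (lt_le_trans (p_gt0 w i tT))//.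
exact: observation_weight_ge.
Qed.

(** * Measurability with respect to the history *)

Lemma bm_loss t i : (0 < t <= T)%N -> bm t.-1 (fun w => l t w i).
Proof.
move=> tT; split; first exact: (loss_predictable env).
exists 1 => w; have /andP[l0 l1] := loss_range env w i tT.
by rewrite ger0_norm.
Qed.

Lemma bm_weight t i j : (0 < t <= T)%N -> bm t.-1 (fun w => s t w i j).
Proof.
move=> tT; split; first exact: (weight_predictable env).
exists 1 => w; have /andP[l0 l1] := weight_range env w i j tT.
by rewrite ger0_norm.
Qed.

Lemma bm_arm t i : (0 < t <= T)%N -> bm t (\1_[set w | I t w = i] : Omega -> R).
Proof.
move=> tT; have /andP[_ tT'] := tT.
exact: (bm_indic (sigF tT') (arm_adapted env i tT)).
Qed.

Lemma bm_noise t i : (0 < t <= T)%N -> bm t (fun w => xi t w i).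
Proof.
move=> tT; split; first exact: (noise_adapted env).
by exists b => w; exact: (noise_bounded env).
Qed.

(** The parameters of round [t] are explicit functions of the past. The delicate one is the inverse
    [W], whose denominator needs a positive constant lower bound even when [gamma] vanishes. *)
Lemma predictable_of_past t : (0 < t <= T)%N ->
  (forall i, bm t.-1 (fun w => Lhat t.-1 w i)) ->
  (forall u, (0 < u < t)%N -> bm t.-1 (Q u)) ->
  [/\ bm t.-1 (eta t), (forall i, bm t.-1 (fun w => p t w i)) &
      (forall i, bm t.-1 (W t i))].
Proof.
move=> tT bL bQ; have sg := sigF (predT tT).
have k0 : 0 < 2 * (1 + b + b ^+ 2) by have := sqr_ge0 b; have := b0; lra.
have be : bm t.-1 (eta t).
  rewrite (_ : eta t = fun w => Num.sqrt (ln N%:R * (2 * (1 + b +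
      b ^+ 2) * (N%:R + \sum_(1 <= u < t) Q u w))^-1)); last first.
    by apply/funext => w; rewrite (wix_rate wix).
  apply: bm_sqrt => //; apply: bmM => //; first exact: bm_cst.
  have N0' : 0 < N%:R :> R by rewrite ltr0n.
  apply: (@bmV _ _ _ _ sg _ (2 * (1 + b + b ^+ 2) * N%:R));
      first exact: mulr_gt0.
    move=> w; rewrite ler_pM2l// lerDl sum_Q_ge0//.
    by case/andP: tT => _ /leqW.
  apply: bmM => //; first exact: bm_cst.
  by apply: bmD => //; [exact: bm_cst|exact: bm_sum_nat].
have bx i : bm t.-1 (fun w => - eta t w * Lhat t.-1 w i).
  by apply: bmM => //; exact: bmN.
(* [eta * Lhat] is bounded by some [m], so every numerator is at least [expR (- m)] and the
   normalising sum at most [N * expR m]. *)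
have [lo lo0 hlo] : exists2 m : R, 0 < m & forall w i, m <= p t w i.
  have /choice[M hM] : forall i, exists M, forall w,
      `|- eta t w * Lhat t.-1 w i| <= M.
    by move=> i; have [] := bx i.
  pose m := \sum_(i < N) `|M i|.
  have hm w i : `|- eta t w * Lhat t.-1 w i| <= m.
    rewrite (le_trans (hM i w))// (le_trans (ler_norm _))// /m (bigD1 i)//=
        lerDl.
    exact: sumr_ge0.
  have Nm : 0 < N%:R * expR m by rewrite mulr_gt0 ?ltr0n ?expR_gt0.
  exists (expR (- m) / (N%:R * expR m)); first by rewrite divr_gt0 ?expR_gt0.
  move=> w i; rewrite (wix_p wix)//; apply: ler_pM;
      rewrite ?invr_ge0 ?expR_ge0 ?(ltW Nm)//.
    by rewrite ler_expR; have := hm w i; rewrite ler_norml => /andP[].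
  rewrite lef_pV2 ?posrE ?sum_expR_gt0//.
  rewrite -[N in leRHS]card_ord mulr_natl -sumr_const; apply: ler_sum => j _.
  by rewrite ler_expR; have := hm w j; rewrite ler_norml => /andP[].
have bp i : bm t.-1 (fun w => p t w i).
  rewrite (_ : (fun w => _) = fun w => expR (- eta t w * Lhat t.-1 w i) *
     (\sum_(j < N) expR (- eta t w * Lhat t.-1 w j))^-1); last first.
    by apply/funext => w; rewrite (wix_p wix).
  apply: bmM => //; first exact: bm_expR.
  have [M hM] : exists M, forall w,
      - eta t w * Lhat t.-1 w i <= M /\ - M <= - eta t w * Lhat t.-1 w i.
    have [_ [M hM]] := bx i; exists M => w; have := hM w.
    by rewrite ler_norml => /andP[].
  apply: (@bmV _ _ _ _ sg _ (expR (- M))); first exact: expR_gt0.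
    move=> w; rewrite (bigD1 i)//= ler_wpDr//.
      by apply: sumr_ge0 => j _; exact: expR_ge0.
    by rewrite ler_expR; have [] := hM w.
  by apply: bm_sum => // j _; exact: bm_expR.
split=> // i.
apply: (@bmV _ _ _ _ sg _ lo) => //.
  move=> w; rewrite (le_trans (hlo w i))// ler_wpDr ?gamma_ge0//.
  exact: observation_weight_ge.
apply: bmD => //.
  apply: bm_sum => // j _; apply: bmM => //.
  by apply: bmX => //; exact: bm_weight.
rewrite (_ : gamma t = fun w => b * eta t w).
  by apply: bmM => //; exact: bm_cst.
by apply/funext => w; rewrite (wix_exploration wix).
Qed.

(** The feedback is a convex combination of a loss in [[0, 1]] and a noise in [[- b, b]], so its
    absolute value is at most [Num.max 1 b]. *)
Lemma feedback_sqr_le t w k i : (0 < t <= T)%N ->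
  feedback (s t w) (l t w) (xi t w) k i ^+ 2 <= 1 + b ^+ 2.
Proof.
move=> tT; rewrite /feedback.
have /andP[s0 s1] := weight_range env w k i tT.
have /andP[l0 l1] := loss_range env w i tT.
have := noise_bounded env w i tT; rewrite ler_norml => /andP[x0 x1].
set c := _ + _.
have [c1 c2] : c <= Num.max 1 b /\ - Num.max 1 b <= c.
  have [m1 mb] : 1 <= Num.max 1 b /\ b <= Num.max 1 b
      by rewrite !le_max !lexx orbT.
  by rewrite /c; split; nra.
have : c ^+ 2 <= Num.max 1 b ^+ 2 by rewrite -subr_ge0 subr_sqr mulr_ge0//; lra.
by move/le_trans; apply; case: (leP 1 b) => _;
    rewrite ?expr1n ?lerDr ?lerDl ?sqr_ge0.
Qed.

Lemma lhatE t w i : (0 < t <= T)%N ->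
  lhat t w i = \sum_(k < N) \1_[set w | I t w = k] w *
     (s t w k i * feedback (s t w) (l t w) (xi t w) k i * W t i w).
Proof.
move=> tT; rewrite (wix_lhat wix)// -/(observation_weight (s t w) (p t w) i).
rewrite (bigD1 (I t w))//= indicE mem_set// mul1r.
rewrite big1 ?addr0// => k kI; rewrite indicE memNset ?mul0r//=.
by move=> h; rewrite h eqxx in kI.
Qed.

(** A conditional expectation in integrated form, [Z] being anything known before the draw. Testing
    on events of the past reduces it to the sampling rule. *)
Lemma E_draw t k Z : (0 < t <= T)%N -> bm t.-1 Z -> bm t.-1 (fun w =>
    p t w k) ->
  E (fun w => Z w * \1_[set w | I t w = k] w) = E (fun w => Z w * p t w k).
Proof.
move=> tT bZ bp; have /andP[_ tT'] := tT.
have bI : bmeas (\1_[set w | I t w =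
    k] : Omega -> R) := bm_meas tT' (bm_arm k tT).
have bp' := bm_pred_meas tT bp; have bZ' := bm_pred_meas tT bZ.
apply/eqP; rewrite -subr_eq0 -EB; [|exact: (bmM sm)|exact: (bmM sm)].
have bW := bmB sm bI bp'.
have := E_mul_eq0 bZ' bW; rewrite (_ : (fun w => _) = fun w =>
    Z w * \1_[set w0 | I t w0 = k] w - Z w * p t w k); last first.
  by apply/funext => w; rewrite mulrBr.
move=> -> // B mB; have FA : F t.-1 (Z @^-1` B) by case: bZ => + _; apply.
have mA : measurable (Z @^-1` B)
    by exact: (filtration_measurable filF (predT tT)).
have mI : measurable [set w | I t w = k]
    by apply: (filtration_measurable filF tT'); exact: (arm_adapted env).
have bA : bmeas (\1_(Z @^-1` B) : Omega -> R) := bm_indic sm mA.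
rewrite (_ : (fun w => _) = fun w =>
    \1_(Z @^-1` B `&` [set w0 | I t w0 = k]) w - (fun w =>
    p t w k) w * \1_(Z @^-1` B) w); last first.
  by apply/funext => w; rewrite indicI mulrBr [X in _ - X]mulrC.
rewrite EB; [|exact: (bm_indic sm (measurableI _ _ mA mI))|exact: (bmM sm)].
rewrite E_indic; last exact: measurableI.
apply/eqP; rewrite subr_eq0; apply/eqP; rewrite (draw _ tT FA).
transitivity (\int[P]_(w in Z @^-1` B) p t w k) => //.
by rewrite Rintegral_mkcond patch_indic.
Qed.

(** The noise averages out against the past and the draw together. [E_mul_eq0] is used twice, on [Z]
    and then on the noise itself, until only probabilities of events remain. *)
Lemma E_noise t k i Z : (0 < t <= T)%N -> bm t.-1 Z ->
  E (fun w => Z w * (\1_[set w | I t w = k] w * xi t w i)) = 0.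
Proof.
move=> tT bZ; have /andP[_ tT'] := tT.
have bI : bmeas (\1_[set w | I t w =
    k] : Omega -> R) := bm_meas tT' (bm_arm k tT).
have bX := bm_meas tT' (bm_noise i tT).
apply: E_mul_eq0; [exact: (bm_pred_meas tT)|exact: (bmM sm)|].
move=> B mB; have FA : F t.-1 (Z @^-1` B) by case: bZ => + _; apply.
have mA : measurable (Z @^-1` B)
    by exact: (filtration_measurable filF (predT tT)).
have mI : measurable [set w | I t w = k]
    by apply: (filtration_measurable filF tT'); exact: (arm_adapted env).
set A := Z @^-1` B `&` [set w | I t w = k].
have mAI : measurable A by exact: measurableI.
have bAI : bmeas (\1_A : Omega -> R) := bm_indic sm mAI.
pose c := fine (P A).
have EX : E (fun w => xi t w i) = 0.
  have := noise_centered env i tT; rewrite expectationEFin//.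
  by case.
(* The indicator is centred: the part [c * xi] vanishes because the noise has mean zero, the rest by
   independence. *)
rewrite (_ : (fun w => _) = fun w => xi t w i * (\1_A w - c) + c * xi t w i);
    last first.
  by apply/funext => w; rewrite /A indicI /=; ring.
have bc := bmB sm bAI (bm_cst sm c).
rewrite ED; [|exact: (bmM sm)|exact: (bmM sm (bm_cst sm c))].
rewrite EZ// EX mulr0 addr0; apply: E_mul_eq0 => // B' mB'.
have mX : measurable ((fun w => xi t w i) @^-1` B') by case: bX => + _; apply.
rewrite (_ : (fun w => _) = fun w => \1_(A `&` (fun w => xi t w i) @^-1` B') w -
     c * \1_((fun w => xi t w i) @^-1` B') w); last first.
  by apply/funext => w; rewrite indicI /=; ring.
have b2 : bmeas (\1_(A `&` (fun w => xi t w i) @^-1` B') : Omega -> R).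
  by apply: (bm_indic sm); exact: measurableI.
have b3 : bmeas (\1_((fun w =>
    xi t w i) @^-1` B') : Omega -> R) := bm_indic sm mX.
rewrite EB//; last exact: (bmM sm (bm_cst sm c)).
rewrite EZ// !E_indic//; last exact: measurableI.
have := noise_independent env k (B := fun j =>
    if j == i then B' else setT) tT FA.
have -> : [set w | forall j, (if j == i then B' else setT) (xi t w j)] =
    (fun w => xi t w i) @^-1` B'.
  apply/seteqP; split => [w /(_ i)|w h j] /=; first by rewrite eqxx.
  by case: eqP => [->|].
rewrite (bigD1 i)//= eqxx big1; last first.
  by move=> j /negbTE ->; exact: probability_setT.
rewrite mule1 => ->; last by move=> j; case: ifP.
by rewrite fineM ?fin_num_measure// subrr.
Qed.

(** Both claims go by one induction, since [eta] of the next round needs all earlier [Q] and [p]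
    needs the current [Lhat]. *)
Lemma predictable_measurable t : (t <= T)%N ->
  (forall i, bm t (fun w => Lhat t w i)) /\
  (forall u, (0 < u <= t)%N -> bm t (Q u)).
Proof.
elim: t => [_|t IH tT].
  split; last by case.
  move=> i; rewrite (_ : (fun w => _) = fun=> 0);
      first exact: bm_cst (sigF (leq0n T)) _.
  by apply/funext => w; rewrite (wix_Lhat0 wix).
have tT' : (0 < t.+1 <= T)%N by [].
have [bL bQ] := IH (ltnW tT).
have [be bp bW] := predictable_of_past tT' bL bQ.
have sg := sigF tT; have sg' := sigF (ltnW tT).
split.
  move=> i; rewrite (_ : (fun w => _) = fun w => Lhat t w i + lhat t.+1 w i);
      last first.
    by apply/funext => w; rewrite (wix_Lhat wix).
  apply: bmD => //; first exact: (bm_next tT').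
  rewrite (_ : (fun w => _) = fun w =>
      \sum_(k < N) \1_[set w | I t.+1 w = k] w *
     (s t.+1 w k i * feedback (s t.+1 w) (l t.+1 w) (xi t.+1 w) k i * W t.+1 i
         w)); last first.
    by apply/funext => w; rewrite lhatE.
  apply: bm_sum => // k _; apply: bmM => //; first exact: bm_arm.
  have bs := bm_next tT' (bm_weight k i tT').
  apply: bmM => //; last exact: (bm_next tT').
  apply: bmM => //; apply: bmD => //; first by apply: bmM => //;
      exact: bm_next (bm_loss i tT').
  apply: bmM => //; last exact: bm_noise.
  by apply: bmB => //; exact: bm_cst.
move=> u /andP[u0]; rewrite leq_eqVlt => /predU1P[->|ut]; last first.
  by apply: (bm_next tT'); apply: bQ; rewrite u0.
apply: (bm_next tT'); rewrite (_ : Q _ = fun w =>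
    \sum_(i < N) p t.+1 w i * W t.+1 i w).
  by apply: bm_sum => // i _; exact: bmM.
by apply/funext => w; rewrite QE.
Qed.

Lemma predictable t : (0 < t <= T)%N ->
  [/\ bm t.-1 (eta t), (forall i, bm t.-1 (fun w => p t w i)),
      (forall i, bm t.-1 (W t i)) & bm t.-1 (Q t)].
Proof.
move=> tT; have [bL bQ] := predictable_measurable (predT tT).
have [||be bp bW] := predictable_of_past tT => //.
  by move=> u /andP[u0 ut]; apply: bQ; rewrite u0 -ltnS prednK//; case/andP: tT.
split=> //; have sg := sigF (predT tT).
rewrite (_ : Q _ = fun w => \sum_(i < N) p t w i * W t i w).
  by apply: bm_sum => // i _; exact: bmM.
by apply/funext => w; rewrite QE.
Qed.

Lemma bm_observation_weight t i : (0 < t <= T)%N -> bm t.-1 (D t i).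
Proof.
move=> tT; have sg := sigF (predT tT); have [_ bp _ _] := predictable tT.
apply: bm_sum => // j _; apply: bmM => //.
by apply: bmX => //; exact: bm_weight.
Qed.

Lemma bm_lhat t i : (0 < t <= T)%N -> bmeas (fun w => lhat t w i).
Proof.
move=> tT; have /andP[_ tT'] := tT.
rewrite (_ : (fun w => _) = fun w => Lhat t w i - Lhat t.-1 w i).
  apply: (bmB sm).
    exact: bm_meas tT' ((predictable_measurable tT').1 i).
  exact: bm_pred_meas tT ((predictable_measurable (predT tT)).1 i).
by apply/funext => w; rewrite (wix_Lhat wix)// addrAC subrr add0r.
Qed.

(** The noise part has mean zero, and averaging [s k i ^+ 2] over the draw produces [D]. Given the
    past, the estimate thus has mean [l * D / (D + gamma)], a shrunken loss. *)
Lemma E_lhat t i Z : (0 < t <= T)%N -> bm t.-1 Z ->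
  E (fun w => Z w * lhat t w i) = E (fun w =>
      Z w * (l t w i * D t i w * W t i w)).
Proof.
move=> tT bZ; have sg := sigF (predT tT); have /andP[_ tT'] := tT.
have [be bp bW bQ] := predictable tT.
have bl := bm_loss i tT; have bs k := bm_weight k i tT.
have bI k : bmeas (\1_[set w | I t w =
    k] : Omega -> R) := bm_meas tT' (bm_arm k tT).
have bX := bm_meas tT' (bm_noise i tT).
(* On the event that arm [k] is drawn, [A] collects the loss part of the feedback and [B] the
   coefficient of its noise part. *)
pose A k w := Z w * (s t w k i ^+ 2 * l t w i * W t i w).
pose B k w := Z w * (s t w k i * (1 - s t w k i) * W t i w).
have bA k : bm t.-1 (A k).
  apply: bmM => //; apply: bmM => //; apply: bmM => //; exact: bmX.
have bB k : bm t.-1 (B k).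
  by apply: bmM => //; apply: bmM => //; apply: bmM => //; apply: bmB => //;
      exact: bm_cst.
have bA' k := bm_pred_meas tT (bA k); have bB' k := bm_pred_meas tT (bB k).
transitivity (E (fun w => \sum_(k < N) (A k w * \1_[set w | I t w = k] w +
    B k w * (\1_[set w | I t w = k] w * xi t w i)))).
  apply: E_ext => w; rewrite lhatE// mulr_sumr; apply: eq_bigr => k _.
  by rewrite /A /B /feedback; ring.
rewrite E_sum; last first.
  by move=> k _; apply: (bmD sm); [exact: (bmM sm)|apply: (bmM sm) => //;
      exact: (bmM sm)].
transitivity (\sum_(k < N) E (fun w => A k w * p t w k)).
  apply: eq_bigr => k _; rewrite ED; last 2 first.
  - exact: (bmM sm).
  - by apply: (bmM sm) => //; exact: (bmM sm).
  by rewrite E_noise// addr0 E_draw.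
rewrite -E_sum; last by move=> k _; apply: (bmM sm) => //;
    exact: bm_pred_meas (bp k).
apply: E_ext => w; rewrite /A /observation_weight;
    under eq_bigr do rewrite -mulrA.
rewrite -mulr_sumr; congr (_ * _); rewrite [RHS]mulrAC mulr_sumr.
by apply: eq_bigr => k _; ring.
Qed.

(** Once the feedback is bounded, the draw averages [s k i ^+ 2 * W ^+ 2] to [D * W ^+ 2], and
    [D * W <= 1]. *)
Lemma E_lhat_sqr_le t i Z : (0 < t <= T)%N -> bm t.-1 Z -> (forall w,
    0 <= Z w) ->
  E (fun w => Z w * lhat t w i ^+ 2) <= (1 + b ^+ 2) * E (fun w =>
      Z w * W t i w).
Proof.
move=> tT bZ Z0; have sg := sigF (predT tT); have /andP[_ tT'] := tT.
have [be bp bW bQ] := predictable tT.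
have bs k := bm_weight k i tT.
have bI k : bmeas (\1_[set w | I t w =
    k] : Omega -> R) := bm_meas tT' (bm_arm k tT).
pose A k w := Z w * (s t w k i ^+ 2 * W t i w ^+ 2).
have bA k : bm t.-1 (A k).
  by apply: bmM => //; apply: bmM => //; exact: bmX.
have bA' k := bm_pred_meas tT (bA k).
have bAI : bmeas (fun w => \sum_(k < N) (A k w * \1_[set w | I t w = k] w)).
  by apply: (bm_sum sm) => k _; exact: (bmM sm).
apply: (@le_trans _ _ ((1 + b ^+ 2) * E (fun w =>
    \sum_(k < N) (A k w * \1_[set w | I t w = k] w)))).
  rewrite -EZ//; apply: E_le.
  - apply: (bmM sm); first exact: bm_pred_meas bZ.
    by apply: (bmX sm); exact: bm_lhat.
  - exact: (bmM sm (bm_cst sm _)).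
  move=> w; rewrite (wix_lhat wix)// -/(observation_weight (s t w) (p t w) i).
  rewrite (bigD1 (I t w))//= indicE mem_set// mulr1.
  rewrite big1 ?addr0; last first.
    move=> k kI; rewrite indicE memNset ?mulr0//=.
    by move=> h; rewrite h eqxx in kI.
  have A0 : 0 <= A (I t w) w by rewrite /A mulr_ge0// mulr_ge0 ?sqr_ge0.
  apply: le_trans (ler_wpM2r A0 (feedback_sqr_le w (I t w) i tT)).
  by rewrite le_eqVlt; apply/orP; left; apply/eqP; rewrite /A; ring.
apply: ler_wpM2l; first by rewrite addr_ge0// sqr_ge0.
rewrite E_sum; last by move=> k _; exact: (bmM sm).
under eq_bigr do rewrite E_draw//.
rewrite -E_sum; last by move=> k _; apply: (bmM sm) => //;
    exact: bm_pred_meas (bp k).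
apply: E_le.
- apply: (bm_sum sm) => k _; apply: (bmM sm) => //; exact: bm_pred_meas (bp k).
- by apply: (bm_pred_meas tT); exact: bmM.
move=> w; under eq_bigr do rewrite /A -mulrA.
rewrite -mulr_sumr ler_wpM2l//.
have w0 := weight_gt0 w i tT.
have -> : \sum_(k < N) s t w k i ^+ 2 * W t i w ^+ 2 * p t w k =
    D t i w * W t i w * W t i w.
  by rewrite /observation_weight !mulr_suml; apply: eq_bigr => k _; ring.
rewrite ler_piMl ?invr_ge0 ?(ltW w0)// ler_pdivrMr// mul1r lerDl.
exact: gamma_ge0.
Qed.

(** * From single rounds to the regret *)

Lemma loss_armE t w : l t w (I t w) =
    \sum_(k < N) l t w k * \1_[set w | I t w = k] w.
Proof.
rewrite (bigD1 (I t w))//= indicE mem_set// mulr1.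
rewrite big1 ?addr0// => k kI; rewrite indicE memNset ?mulr0//=.
by move=> h; rewrite h eqxx in kI.
Qed.

Lemma bm_loss_arm t : (0 < t <= T)%N -> bmeas (fun w => l t w (I t w)).
Proof.
move=> tT; have /andP[_ tT'] := tT.
under [X in bmeas X]eq_fun do rewrite loss_armE.
apply: (bm_sum sm) => k _; apply: (bmM sm);
    first exact: bm_pred_meas (bm_loss k tT).
exact: bm_meas tT' (bm_arm k tT).
Qed.

Lemma E_loss_arm t : (0 < t <= T)%N ->
  E (fun w => l t w (I t w)) = E (fun w => \sum_(k < N) p t w k * l t w k).
Proof.
move=> tT; have /andP[_ tT'] := tT.
have [be bp bW bQ] := predictable tT.
have bl k := bm_pred_meas tT (bm_loss k tT).
have bp' k := bm_pred_meas tT (bp k).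
have bI k : bmeas (\1_[set w | I t w =
    k] : Omega -> R) := bm_meas tT' (bm_arm k tT).
rewrite (E_ext _ (loss_armE t)) E_sum; last by move=> k _; exact: (bmM sm).
under eq_bigr => k _.
  rewrite E_draw//; last exact: bm_loss.
  over.
rewrite -E_sum; last by move=> k _; exact: (bmM sm).
by apply: E_ext => w; apply: eq_bigr => k _; rewrite mulrC.
Qed.

(** The exploration bias costs [b] times the mean of [eta * Q], the second-order term
    [2 * (1 + b ^+ 2)] times it; both fit in the constant [2 * (1 + b + b ^+ 2)] of the learning
    rate. *)
Lemma E_round_ge t : (0 < t <= T)%N ->
  E (fun w => l t w (I t w)) -
    2 * (1 + b + b ^+ 2) * E (fun w => eta t w * Q t w) <=
  E (fun w => \sum_(i < N) p t w i * lhat t w i -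
    2 * eta t w * \sum_(i < N) p t w i * lhat t w i ^+ 2).
Proof.
move=> tT; have sg := sigF (predT tT).
have [be bp bW bQ] := predictable tT.
have bl k := bm_loss k tT; have bD k := bm_observation_weight k tT.
have mh i := bm_lhat i tT.
have mp i := bm_pred_meas tT (bp i); have me := bm_pred_meas tT be.
have mQ := bm_pred_meas tT bQ.
have mph i : bmeas (fun w => p t w i * lhat t w i) by exact: (bmM sm).
have bep i : bm t.-1 (fun w => eta t w * p t w i) by exact: bmM.
have mep i : bmeas (fun w => eta t w * p t w i * lhat t w i ^+ 2).
  by apply: (bmM sm); [exact: (bm_pred_meas tT)|exact: (bmX sm)].
have meQ : bmeas (fun w => eta t w * Q t w) by exact: (bmM sm).
rewrite (_ : E (fun w => _ - _ * _) = E (fun w =>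
    \sum_(i < N) p t w i * lhat t w i -
    2 * \sum_(i < N) eta t w * p t w i * lhat t w i ^+ 2)); last first.
  apply: E_ext => w; rewrite -[in LHS]mulrA [in LHS]mulr_sumr;
      congr (_ - _ * _).
  by apply: eq_bigr => i _; rewrite mulrA.
have mS : bmeas (fun w => \sum_(i < N) eta t w * p t w i * lhat t w i ^+ 2).
  exact: (bm_sum sm).
rewrite EB; [|exact: (bm_sum sm)|exact: (bmM sm (bm_cst sm _))].
rewrite EZ// !E_sum//.
have H1 : \sum_(i < N) E (fun w => eta t w * p t w i * lhat t w i ^+ 2) <=
    (1 + b ^+ 2) * E (fun w => eta t w * Q t w).
  apply: (@le_trans _ _ (\sum_(i < N) (1 + b ^+ 2) * E (fun w =>
      eta t w * p t w i * W t i w))).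
    apply: ler_sum => i _; apply: E_lhat_sqr_le => // w.
    by rewrite mulr_ge0 ?eta_ge0// ltW// p_gt0.
  rewrite -mulr_sumr -E_sum; last by move=> i _; apply: (bm_pred_meas tT);
      exact: bmM.
  rewrite le_eqVlt; apply/orP; left; apply/eqP; congr (_ * _);
      apply: E_ext => w.
  by rewrite QE// /total_inverse_weight mulr_sumr; apply: eq_bigr => i _;
      rewrite mulrA.
(* [l - l * D / (D + gamma)] is [l * gamma / (D + gamma)], so with losses at most 1 the total bias
   is at most [gamma * Q = b * eta * Q]. *)
have H2 : E (fun w => l t w (I t w)) - b * E (fun w => eta t w * Q t w) <=
    \sum_(i < N) E (fun w => p t w i * lhat t w i).
  under eq_bigr do rewrite E_lhat//.
  rewrite E_loss_arm// -EZ// -EB; last 2 first.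
  - by apply: (bm_sum sm) => k _; apply: (bm_pred_meas tT); exact: bmM.
  - exact: (bmM sm (bm_cst sm _)).
  have bb i : bmeas (fun w => p t w i * (l t w i * D t i w * W t i w)).
    by apply: (bm_pred_meas tT); apply: bmM => //; apply: bmM => //; exact: bmM.
  rewrite -E_sum//; apply: E_le.
  - apply: (bmB sm); last exact: (bmM sm (bm_cst sm _)).
    by apply: (bm_sum sm) => k _; apply: (bm_pred_meas tT); exact: bmM.
  - exact: (bm_sum sm).
  move=> w; rewrite lerBlDr -lerBlDl -sumrB.
  rewrite mulrA -(wix_exploration wix)// QE// /total_inverse_weight mulr_sumr.
  apply: ler_sum => i _.
  have w0 := weight_gt0 w i tT; have p0 := p_gt0 w i tT.
  have /andP[l0 l1] := loss_range env w i tT.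
  set v := _ + gamma t w in w0 *; set D0 := observation_weight _ _ _ in v w0 *.
  have -> : p t w i * l t w i - p t w i * (l t w i * D0 / v) =
      l t w i * (gamma t w * (p t w i / v)).
    by rewrite /v; field; rewrite gt_eqF.
  by rewrite ler_piMl// mulr_ge0 ?gamma_ge0// divr_ge0// ltW.
have eQ0 : 0 <= E (fun w => eta t w * Q t w).
  rewrite -[leLHS](E_cst P 0); apply: E_le => //; first exact: bm_cst.
  by move=> w; rewrite mulr_ge0 ?eta_ge0//; have /andP[] := Q_bounds w tT.
have bQ0 := mulr_ge0 b0 eQ0; lra.
Qed.

Lemma E_Lhat_le j : E (fun w => Lhat T w j) <= E (fun w =>
    \sum_(1 <= t < T.+1) l t w j).
Proof.
have LE w t : (t <= T)%N -> Lhat t w j = \sum_(1 <= u < t.+1) lhat u w j.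
  elim: t => [_|t IH tT]; first by rewrite big_geq// (wix_Lhat0 wix).
  by rewrite big_nat_recr//= -IH ?(ltnW tT)// (wix_Lhat wix).
rewrite (E_ext _ (fun w => LE w T (leqnn T))).
rewrite !E_sum_nat; last 2 first.
- by move=> t tT; apply: (bm_pred_meas tT); exact: bm_loss.
- by move=> t tT; exact: bm_lhat.
rewrite !big_nat; apply: ler_sum => t tT.
have sg := sigF (predT tT).
rewrite (_ : E (fun w => lhat t w j) = E (fun w => 1 * lhat t w j)); last first.
  by apply: E_ext => w; rewrite mul1r.
rewrite E_lhat//; last exact: bm_cst.
have [be bp bW bQ] := predictable tT.
have bl := bm_loss j tT; have bD := bm_observation_weight j tT.
apply: E_le.
- apply: (bm_pred_meas tT); apply: bmM => //; first exact: bm_cst.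
  by apply: bmM => //; exact: bmM.
- exact: (bm_pred_meas tT).
move=> w; rewrite mul1r -mulrA ler_piMr//.
  by have /andP[] := loss_range env w j tT.
by rewrite ler_pdivrMr ?mul1r ?lerDl ?gamma_ge0// weight_gt0.
Qed.

(** The learning rate is random, so exponential weights and the tuning bound are combined on each
    path; expectations are taken afterwards. *)
Lemma E_regret_le j : (1 < N)%N -> (0 < T)%N ->
  E (fun w => \sum_(1 <= t < T.+1) l t w (I t w) - \sum_(1 <= t < T.+1) l t w
      j) <=
  4 * Num.sqrt (2 * (1 + b + b ^+ 2) * ln N%:R) *
    E (fun w => Num.sqrt (N%:R + \sum_(1 <= t < T.+1) Q t w)).
Proof.
move=> N1 T0; set k := 2 * (1 + b + b ^+ 2).
have k0 : 0 < k by rewrite /k; have := sqr_ge0 b; have := b0; lra.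
have mQ t : (0 < t <= T)%N -> bmeas (Q t).
  by move=> tT; have [_ _ _ bQ] := predictable tT; exact: (bm_pred_meas tT).
have me t : (0 < t <= T)%N -> bmeas (eta t).
  by move=> tT; have [be _ _ _] := predictable tT; exact: (bm_pred_meas tT).
have mp t i : (0 < t <= T)%N -> bmeas (fun w => p t w i).
  by move=> tT; have [_ bp _ _] := predictable tT; exact: (bm_pred_meas tT).
have meQ t : (0 < t <= T)%N -> bmeas (fun w => eta t w * Q t w).
  by move=> tT; apply: (bmM sm); [exact: me|exact: mQ].
pose S w := Num.sqrt (N%:R + \sum_(1 <= t < T.+1) Q t w).
have mS : bmeas S.
  apply: (bm_sqrt sm); apply: (bmD sm); first exact: bm_cst.
  exact: (bm_sum_nat sm).
pose v t w := \sum_(i < N) p t w i * lhat t w i -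
    2 * eta t w * \sum_(i < N) p t w i * lhat t w i ^+ 2.
have mv t : (0 < t <= T)%N -> bmeas (v t).
  move=> tT; apply: (bmB sm).
    by apply: (bm_sum sm) => i _; apply: (bmM sm); [exact: mp|exact: bm_lhat].
  apply: (bmM sm); first by apply: (bmM sm); [exact: bm_cst|exact: me].
  apply: (bm_sum sm) => i _; apply: (bmM sm); first exact: mp.
  by apply: (bmX sm); exact: bm_lhat.
have mL : bmeas (fun w => Lhat T w j).
  exact: bm_meas (leqnn T) ((predictable_measurable (leqnn T)).1 j).
have ml t : (0 < t <= T)%N -> bmeas (fun w => l t w j).
  by move=> tT; apply: (bm_pred_meas tT); exact: bm_loss.
have lN0 : 0 < ln N%:R :> R by rewrite ln_gt0// ltr1n.
have etaP w t : (0 < t <= T)%N -> 0 < eta t w.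
  move=> tT; rewrite (wix_rate wix)// sqrtr_gt0 divr_gt0// mulr_gt0//.
  rewrite ltr_pwDl ?ltr0n// sum_Q_ge0//; by case/andP: tT => _ /leqW.
have path w : \sum_(1 <= t < T.+1) v t w +
    k * (\sum_(1 <= t < T.+1) eta t w * Q t w) <=
    Lhat T w j + 4 * Num.sqrt (k * ln N%:R) * S w.
  have H1 := @adaptive_rate_bound R N T k (fun t => Q t w) (fun t =>
      eta t w) N1 k0 T0
    (fun t tT => Q_bounds w tT) (fun t tT => wix_rate wix w tT).
  suff : \sum_(1 <= t < T.+1) v t w <= Lhat T w j + ln N%:R / eta T w
      by move: H1; rewrite -/(S w); lra.
  apply: (@exponential_weights_bound R N T (fun t => eta t w) (fun t =>
      lhat t w)
     (fun t => Lhat t w) (fun t => p t w)) => //.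
  - by move=> t; exact: etaP.
  - move=> t /andP[t0 tT]; rewrite (wix_rate wix)// (wix_rate wix);
      last by rewrite t0 ltnW.
    rewrite ler_wsqrtr// ler_pM2l// lef_pV2 ?posrE.
    + rewrite ler_pM2l// big_nat_recr//= addrA lerDl.
      by have /andP[] : 0 <= Q t w <= N%:R by apply: Q_bounds; rewrite t0 ltnW.
    + by rewrite mulr_gt0// ltr_pwDl ?ltr0n// sum_Q_ge0// leqW.
    + by rewrite mulr_gt0// ltr_pwDl ?ltr0n// sum_Q_ge0// leqW// ltnW.
  - by move=> i; rewrite (wix_Lhat0 wix).
  - by move=> t i tT; rewrite (wix_Lhat wix).
  - by move=> t i tT; rewrite (wix_p wix).
  (* This is the purpose of [gamma = b * eta]: the numerator of [eta * lhat] is at least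
     [- b * eta], and its denominator is at least [gamma]. *)
  move=> t i tT; rewrite (wix_lhat wix)// -/(observation_weight (s t w) (p t w)
      i).
  have w0 := weight_gt0 w i tT; have e0 := etaP w t tT.
  rewrite mulrA ler_pdivlMr// mulN1r.
  have D0 : 0 <= D t i w by rewrite (le_trans _ (observation_weight_ge w i
      tT))// ltW// p_gt0.
  rewrite (wix_exploration wix)//.
  have /andP[s0 s1] := weight_range env w (I t w) i tT.
  have /andP[l0 l1] := loss_range env w i tT.
  have := noise_bounded env w i tT; rewrite ler_norml => /andP[x0 x1].
  have : - b <= s t w (I t w) i * feedback (s t w) (l t w) (xi t w) (I t w) i.
    rewrite /feedback; set a := s _ _ _ _ in s0 s1 *;
        set y := xi _ _ _ in x0 x1 *.
    have h1 : 0 <= a * (a * l t w i) by rewrite !mulr_ge0.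
    have h2 : 0 <= a * (1 - a) * (y + b) by rewrite !mulr_ge0//; lra.
    have h3 : 0 <= b * (1 - a * (1 - a)) by rewrite mulr_ge0//; nra.
    nra.
  by rewrite -(ler_pM2l e0); lra.
have EP := @E_le _ _ _ P _ _ _ _ path.
have msum (f : nat -> Omega -> R) : (forall t,
    (0 < t <= T)%N -> bmeas (f t)) -> bmeas (fun w =>
    \sum_(1 <= t < T.+1) f t w).
  by move=> h; apply: (bm_sum_nat sm) => t tT; exact: h.
have mcM c (f : Omega -> R) : bmeas f -> bmeas (fun w => c * f w).
  by move=> ?; apply: (bmM sm) => //; exact: bm_cst.
have {}EP := EP (bmD sm (msum _ mv) (mcM _ _ (msum _ meQ))) (bmD sm mL (mcM _ _
    mS)).
move: EP; rewrite (ED P (msum _ mv) (mcM _ _ (msum _ meQ))) (ED P mL (mcM _ _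
    mS)).
rewrite (EZ P _ (msum _ meQ)) (EZ P _ mS) (E_sum_nat P (m := 1) (n := T.+1) mv)
    (E_sum_nat P (m := 1) (n := T.+1) meQ) => EP.
rewrite EB; [|by apply: msum => t; exact: bm_loss_arm|exact: msum].
have := E_Lhat_le j.
have : \sum_(1 <= t < T.+1) E (fun w => l t w (I t w)) -
   k * \sum_(1 <= t < T.+1) E (fun w =>
       eta t w * Q t w) <= \sum_(1 <= t < T.+1) E (v t).
  rewrite mulr_sumr -sumrB !big_nat; apply: ler_sum => t tT; exact: E_round_ge.
rewrite (E_sum_nat P (h := fun t w => l t w (I t w))); last by move=> t;
    exact: bm_loss_arm.
rewrite -/S; lra.
Qed.

End process.

(** * Comparison with the effective independence numbers *)

Section final.
Context (R : realType) (N T : nat) (b : R) d (Omega : measurableType d)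
  (P : probability Omega R) (F : nat -> set (set Omega))
  (l : nat -> Omega -> 'I_N -> R) (s : nat -> Omega -> 'I_N -> 'I_N -> R)
  (I : nat -> Omega -> 'I_N) (xi : nat -> Omega -> 'I_N -> R)
  (eta gamma Q : nat -> Omega -> R) (p lhat Lhat : nat -> Omega -> 'I_N -> R).
Context (N0 : (0 < N)%N) (b0 : 0 <= b) (filF : is_filtration T F)
  (env : noisy_environment P T b F l s I xi)
  (wix : exp3_wix T b l s I xi eta gamma Q p lhat Lhat)
  (draw : drawn_according_to P T F I p).

Lemma log_inv_noise_ge0 : 0 <= log_inv_noise N b.
Proof.
rewrite /log_inv_noise; case: eqP => // /eqP b1;
    rewrite le_min ler0n/= ln_ge0//.
by rewrite lerDl invr_ge0.
Qed.

Lemma ln_size_ge1 : (1 < N)%N -> 1 <= ln (2 + N%:R + T%:R) :> R.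
Proof.
move=> N1; have h : 4 <= 2 + N%:R + T%:R :> R.
  have : 2 <= N%:R :> R by rewrite ler_nat.
  by have := ler0n R T; lra.
have e4 : expR 1 <= 4 :> R by have := @expR_le_quadratic R 1; lra.
by rewrite -ler_expR lnK ?posrE; lra.
Qed.

(** [Q_t <= N] keeps the rate above [1 / ((1 + b) * (N + T))]; dividing by [b] turns [1 + b] into
    [1 + b^-1], the source of the logarithmic dependence on [1 / b]. *)
Lemma inv_gamma_le t w : (0 < t <= T)%N -> (1 < N)%N -> 0 < b ->
  0 < gamma t w /\ 1 + (gamma t w)^-1 <= (1 + b^-1) * (2 + N%:R + T%:R).
Proof.
move=> tT N1 b_gt0.
have T0 : (0 < T)%N by case/andP: tT => t0 /(leq_trans t0).
have N1' : 1 <= N%:R :> R by rewrite ler1n.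
have T1' : 1 <= T%:R :> R by rewrite ler1n.
have ln_half : 1 / 2 <= ln N%:R :> R.
  have : ln 2 <= ln N%:R :> R by rewrite ler_ln ?posrE ?ltr0n// ler_nat.
  have : expR (1 / 2) <= 2 :> R by have := @expR_le_quadratic R (1/2); lra.
  rewrite -[X in _ <= X -> _](@lnK R 2) ?posrE// ler_expR; lra.
set S := N%:R + \sum_(1 <= u < t) Q u w.
have S0 : 0 < S by rewrite /S ltr_pwDl ?ltr0n// (sum_Q_ge0 N0 b0 env wix)//;
    case/andP: tT => _ /leqW.
have SNT : S <= N%:R * T%:R.
  have : \sum_(1 <= u < t) Q u w <= \sum_(1 <= u < t) N%:R.
    rewrite !big_nat; apply: ler_sum => u /andP[u0 ut].
    have /andP[//] : 0 <= Q u w <= N%:R.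
    apply: (Q_bounds N0 b0 env wix); rewrite u0/= ltnW// (leq_trans ut)//.
    by case/andP: tT.
  rewrite sumr_const_nat -[N%:R *+ _]mulr_natr => h.
  case/andP: tT => t0 tT; have : (t - 1)%:R + 1 <= T%:R :> R.
    by rewrite natr1 ler_nat subn1 prednK.
  by rewrite /S; nra.
have eE := wix_rate wix w tT; rewrite -/S in eE.
set k := 2 * (1 + b + b ^+ 2) in eE.
have k0 : 0 < k by rewrite /k; have := sqr_ge0 b; lra.
have e0 : 0 < eta t w by rewrite eE sqrtr_gt0 (divr_gt0 _ (mulr_gt0 k0 S0))//;
    lra.
rewrite (wix_exploration wix)//; split; first exact: mulr_gt0.
pose A : R := N%:R + T%:R.
have A0 : 0 < A by rewrite /A; lra.
(* After squaring, this follows from [1 + b + b ^+ 2 <= (1 + b) ^+ 2], [S <= N * T],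
   [4 * N * T <= (N + T) ^+ 2] and [ln N >= 1 / 2]. *)
have eA : 1 <= eta t w * ((1 + b) * A).
  rewrite -(ler_pXn2r (n := 2))// ?nnegrE ?mulr_ge0//; try lra.
  rewrite expr1n exprMn eE sqr_sqrtr;
      last by rewrite (divr_ge0 _ (mulr_ge0 (ltW k0) (ltW S0)))//; lra.
  rewrite mulrAC ler_pdivlMr ?(mulr_gt0 k0 S0)// mul1r.
  apply: (@le_trans _ _ (2 * (1 + b) ^+ 2 * (N%:R * T%:R))).
    apply: ler_pM; rewrite ?(ltW k0) ?(ltW S0)//; rewrite /k; nra.
  apply: (@le_trans _ _ (1 / 2 * ((1 + b) * A) ^+ 2)); last first.
    by rewrite ler_wpM2r ?sqr_ge0.
  rewrite exprMn /A; have := sqr_ge0 (N%:R - T%:R : R);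
      have : 0 <= (1 + b) ^+ 2 by rewrite sqr_ge0.
  set x := (1 + b) ^+ 2; set n := N%:R; set m := T%:R => hx hn.
  have := mulr_ge0 hx hn; lra.
have : (b * eta t w)^-1 <= (1 + b^-1) * A.
  rewrite -[leLHS]mul1r ler_pdivrMr ?mulr_gt0//; apply: (le_trans eA).
  rewrite le_eqVlt; apply/orP; left; apply/eqP; field; rewrite gt_eqF//.
have : 0 < b^-1 by rewrite invr_gt0.
rewrite -addrA -/A; set x := b^-1; lra.
Qed.

(** Two bounds make up the minimum in [log_inv_noise]: the trivial [Q_t <= N] and, for [b > 0], the
    graph bound with [1 / gamma_t] estimated. *)
Lemma Q_le_effective t w : (0 < t <= T)%N -> (1 < N)%N ->
  Q t w <= 2 * ln (2 + N%:R + T%:R) * (1 + log_inv_noise N b) *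
    effective_independence_number (s t w).
Proof.
move=> tT N1.
have L1 := ln_size_ge1 N1; have M0 := log_inv_noise_ge0.
have a1 := effective_independence_number_ge1 (s t w) N0.
have /andP[_ QN] := Q_bounds N0 b0 env wix w tT.
set L := ln _ in L1 *; set a := effective_independence_number _ in a1 *.
have QNa : Q t w <= 2 * L * (1 + N%:R) * a.
  have n0 := ler0n R N; apply: (le_trans QN).
  have h1 : 1 + N%:R <= 2 * L * (1 + N%:R) by rewrite ler_peMl//; lra.
  have h2 : 2 * L * (1 + N%:R) <= 2 * L * (1 + N%:R) * a by rewrite ler_peMr//;
      lra.
  lra.
move: M0; rewrite /log_inv_noise; case: eqP => [_ _ //|/eqP bn0].
have b_gt0 : 0 < b by rewrite lt0r bn0.
have l0 : 0 <= ln (1 + b^-1) by rewrite ln_ge0// lerDl invr_ge0.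
rewrite minEle; case: ifP => _ // _.
have [g0 gl] := inv_gamma_le w tT N1 b_gt0.
have := @total_inverse_weight_le_effective R N (s t w) (p t w) (gamma t w) N0
  (fun i => p_gt0 N0 wix w i tT) (p_sum1 N0 wix w tT) g0 (fun i =>
      weight_loop env w i tT).
rewrite -(QE wix)// -/a => /le_trans; apply.
have a2 : 0 <= 2 * a by lra.
(* The logarithm is at most [L + ln (1 + b^-1)], and [L >= 1] turns this sum into a product. *)
suff : ln (1 + (gamma t w)^-1) <= L * (1 + ln (1 + b^-1))
    by move=> /(ler_wpM2l a2); lra.
have u0 : 0 < 1 + b^-1 by rewrite ltr_pwDl// invr_ge0.
have v0 : 0 < 2 + N%:R + T%:R :> R
    by rewrite -addrA ltr_pwDl// addr_ge0// ler0n.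
apply: (@le_trans _ _ (ln ((1 + b^-1) * (2 + N%:R + T%:R)))).
  by rewrite ler_ln ?posrE ?mulr_gt0// ltr_pwDl// invr_ge0 ltW.
rewrite lnM ?posrE// -/L; set x := ln _ in l0 *.
have : 0 <= (L - 1) * x by rewrite mulr_ge0//; lra.
lra.
Qed.

End final.

(** Read off the integral as a supremum over simple functions, so that measurability of the
    effective independence number is never at stake. *)
Lemma le_integral_ge0 (R : realType) d (Omega : measurableType d)
    (mu : measure Omega R) (f g : Omega -> \bar R) :
  (forall w, 0 <= f w)%E -> (forall w, f w <= g w)%E ->
  (\int[mu]_w f w <= \int[mu]_w g w)%E.
Proof.
move=> f0 fg; rewrite !ge0_integralTE//; last by move=> w;
    exact: le_trans (fg w).
by apply: ereal_sup_le => _ [h /= hf <-]; exists h => //= w;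
    exact: le_trans (fg w).
Qed.

Theorem theorem2 (R : realType) :
  exists (C : R) (k : nat),
  forall (N T : nat) (b : R)
    (d : measure_display) (Omega : measurableType d) (P : probability Omega R)
    (F : nat -> set (set Omega))
    (l : nat -> Omega -> 'I_N -> R) (s : nat -> Omega -> 'I_N -> 'I_N -> R)
    (I : nat -> Omega -> 'I_N) (xi : nat -> Omega -> 'I_N -> R)
    (eta gamma Q : nat -> Omega -> R) (p lhat Lhat : nat -> Omega -> 'I_N -> R),
  (0 < N)%N -> 0 <= b ->
  is_filtration T F ->
  noisy_environment P T b F l s I xi ->
  exp3_wix T b l s I xi eta gamma Q p lhat Lhat ->
  drawn_according_to P T F I p ->
  (regret P T l I <=
   (log_factor C k N T b)%:E *
   ((1 + b)%:E *
    'E_P[fun w => Num.sqrt (N%:R +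
      \sum_(1 <= t < T.+1) effective_independence_number (s t w))%R]))%E.
Proof.
(* [8 = 4 * 2]: the 4 of the regret bound, and [2 * L] from two factors [Num.sqrt (2 * L)], one due
   to the learning rate and one to [K]; hence also the exponent 1. *)
exists 8, 1%N => N T b d Omega P F l s I xi eta gamma Q p lhat Lhat N0 b0 filF
    env wix draw.
have M0 := log_inv_noise_ge0 N b0.
have N1' : 1 <= N%:R :> R by rewrite ler1n.
have lf0 : 0 <= log_factor 8 1 N T b.
  by rewrite /log_factor expr1 mulr_ge0 ?sqrtr_ge0// mulr_ge0// ln_ge0//;
      have := ler0n R T; lra.
pose a w := N%:R + \sum_(1 <= t < T.+1) effective_independence_number (s t w).
have EY0 : (0 <= 'E_P[fun w => Num.sqrt (a w)])%E.
  by apply: expectation_ge0 => w; exact: sqrtr_ge0.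
rewrite /regret; apply: bigmax_le => [|j _]; first exact: leNye.
have rhs0 : (0 <= (log_factor 8 1 N T b)%:E * ((1 + b)%:E * 'E_P[fun w =>
    Num.sqrt (a w)]))%E.
  by rewrite mule_ge0 ?lee_fin// mule_ge0 ?lee_fin// addr_ge0.
(* Without rounds, or with a single arm, the regret is 0; otherwise [ln N%:R] and [eta T] are
   positive. *)
have [T0|T0] := posnP T.
  rewrite (_ : (fun w => _) = cst 0) ?expectation_cst//.
  by apply/funext => w; rewrite T0 !big_geq// subrr.
have [N1|N1] := ltnP 1 N; last first.
  rewrite (_ : (fun w => _) = cst 0) ?expectation_cst//.
  apply/funext => w; rewrite -sumrB big1// => t _.
  suff -> : I t w = j by rewrite subrr.
  have ord_eq0 (i : 'I_N) : nat_of_ord i = 0%N.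
    by apply/eqP; rewrite -leqn0 -ltnS (leq_trans (ltn_ord i)).
  by apply/val_inj; rewrite /= !ord_eq0.
have L1 := @ln_size_ge1 R N T N1.
have sm := @sigma_algebra_measurable d Omega.
have mloss : bounded_sub_measurable (@measurable d Omega)
    (fun w => \sum_(1 <= t < T.+1) l t w (I t w) - \sum_(1 <= t < T.+1) l t w
        j).
  apply: (bmB sm); apply: (bm_sum_nat sm) => t tT.
    exact: (bm_loss_arm filF env tT).
  by apply: (bm_pred_meas filF tT); exact: (bm_loss env).
rewrite (expectationEFin P mloss).
pose X w := Num.sqrt (N%:R + \sum_(1 <= t < T.+1) Q t w).
have mX : bounded_sub_measurable (@measurable d Omega) X.
  apply: (bm_sqrt sm); apply: (bmD sm); first exact: bm_cst.
  apply: (bm_sum_nat sm) => t tT; apply: (bm_pred_meas filF tT).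
  by have [] := predictable N0 b0 filF env wix tT.
have reg := E_regret_le N0 b0 filF env wix draw j N1 T0.
set L := ln (2 + N%:R + T%:R) in L1 *.
set m := log_inv_noise N b in M0 *.
(* The price of replacing each [Q_t] by the effective independence number under the root. *)
pose K := Num.sqrt (2 * L * (1 + m)).
have K0 : 0 < K by rewrite /K sqrtr_gt0 !mulr_gt0//; lra.
have XY w : K^-1 * X w <= Num.sqrt (a w).
  rewrite mulrC ler_pdivrMr// mulrC /K /X -sqrtrM ?mulr_ge0//; try lra.
  apply: ler_wsqrtr; rewrite /a mulrDr mulr_sumr lerD//.
    by rewrite ler_peMl// mulr_ege1//; lra.
  rewrite !big_nat; apply: ler_sum => t tT.
  exact: (Q_le_effective N0 b0 env wix).
have mKX := bmM sm (bm_cst sm K^-1) mX.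
have EXY : ((K^-1 * \int[P]_w X w)%:E <= 'E_P[fun w => Num.sqrt (a w)])%E.
  rewrite -(EZ _ _ mX) -(expectationEFin P mKX) unlock;
      apply: le_integral_ge0 => w.
    by rewrite lee_fin mulr_ge0 ?sqrtr_ge0// invr_ge0 ltW.
  by rewrite lee_fin.
have EX0 : 0 <= K^-1 * \int[P]_w X w.
  by rewrite mulr_ge0 ?invr_ge0 ?(ltW K0)//; apply: Rintegral_ge0 => w _;
      exact: sqrtr_ge0.
have b1 : 0 <= 1 + b by rewrite addr_ge0.
have lf0' : (0 <= (log_factor 8 1 N T b)%:E)%E by rewrite lee_fin.
have b1' : (0 <= (1 + b)%:E)%E by rewrite lee_fin.
apply: le_trans (lee_wpmul2l lf0' (lee_wpmul2l b1' EXY)).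
rewrite -!EFinM lee_fin; apply: (le_trans reg).
rewrite -/X; set x := \int[P]_w X w in EX0 *.
have -> : x = K * (K^-1 * x) by rewrite mulrA divff ?mul1r// gt_eqF.
rewrite [K^-1 * (K * _)]mulrA mulVf ?mul1r ?gt_eqF//.
rewrite !(mulrA _ _ (K^-1 * x)); apply: ler_wpM2r => //.
have KE : K = Num.sqrt (2 * L) * Num.sqrt (1 + m) by rewrite /K sqrtrM//; lra.
have r2 : Num.sqrt (2 * L) * Num.sqrt (2 * L) = 2 * L
    by rewrite -expr2 sqr_sqrtr//; lra.
have lnL : ln N%:R <= L.
  by rewrite /L ler_ln ?posrE; have := ler0n R T; lra.
(* The factor [1 + b] of the statement comes from [1 + b + b ^+ 2 <= (1 + b) ^+ 2]. *)
have sq : Num.sqrt (2 * (1 + b + b ^+ 2) * ln N%:R) <= (1 +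
    b) * Num.sqrt (2 * L).
  have -> : (1 + b) * Num.sqrt (2 * L) = Num.sqrt ((1 + b) ^+ 2 * (2 * L)).
    by rewrite [RHS]sqrtrM ?sqr_ge0// sqrtr_sqr ger0_norm.
  apply: ler_wsqrtr; have -> : (1 + b) ^+ 2 * (2 * L) = 2 * (1 + b) ^+ 2 * L
      by ring.
  have := sqr_ge0 b; have l0 : 0 <= ln N%:R :> R by rewrite ln_ge0.
  by move=> bb; apply: ler_pM => //; nra.
rewrite KE /log_factor expr1 -/L -/m.
have := ler_wpM2r (sqrtr_ge0 (2 * L)) sq; rewrite -[X in _ <= X -> _]mulrA r2.
move=> /(ler_wpM2r (sqrtr_ge0 (1 + m))); lra.
Qed.
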